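(* Let $N\in\mathcal{LC}$. Then the set of sequences $M\in\mathbb{R}_{>0}^{\mathbb{N}}$ satisfying $M\le N$, $\liminf_{p\to+\infty}(M_p/p!)^{1/p}>0$ resp. $\lim_{p\to+\infty}(M_p/p!)^{1/p}=+\infty$, and $$\mathcal{B}(\mathcal{D}_{\{N\}}([-1,1]))\supseteq\Lambda_{\{M\}},\quad\text{resp.}\quad\mathcal{B}(\mathcal{D}_{(N)}([-1,1]))\supseteq\Lambda_{(M)},$$ has a maximal element, which is given by the formula ($s\in\mathbb{N}_{>0}$) $$L^s_0:=1,\qquad L^s_p:=s^p\min_{0\le j\le p-1}\left\{\left(\frac{p}{\sum_{k\ge p}\frac{1}{\nu_k}}\right)^{p-j}N_j\right\},\quad p\in\mathbb{N}_{>0}.$$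
   Context: $\mathbb{N}=\{0,1,2,\dots\}$, $\mathbb{N}_{>0}=\{1,2,\dots\}$. $\mathcal{LC}$ is the set of sequences $N\in\mathbb{R}_{>0}^{\mathbb{N}}$ that are normalized ($1=N_0\le N_1$), log-convex ($N_j^2\le N_{j-1}N_{j+1}$ for $j\ge1$) and satisfy $\lim_{j\to+\infty}(N_j)^{1/j}=+\infty$. Put $\nu_j:=N_j/N_{j-1}$ for $j\ge1$ and $\nu_0:=1$. $M\le N$ means $M_j\le N_j$ for all $j\in\mathbb{N}$. $M\preceq N$ means $\sup_{j\ge1}(M_j/N_j)^{1/j}<+\infty$. Maximality is understood with respect to the relation $\preceq$. The sequences $L^s$, $s\in\mathbb{N}_{>0}$, are pairwise equivalent, i.e. $L^s\preceq L^t$ and $L^t\preceq L^s$ for all $s,t\in\mathbb{N}_{>0}$. For $M\in\mathbb{R}_{>0}^{\mathbb{N}}$ and $h>0$: $\Lambda_{M,h}:=\{(a_p)_p\in\mathbb{C}^{\mathbb{N}}:\sup_{p\in\mathbb{N}} |a_p|/(h^pM_p)<+\infty\}$, $\Lambda_{\{M\}}:=\bigcup_{h>0}\Lambda_{M,h}$ (Roumieu-type), $\Lambda_{(M)}:=\bigcap_{h>0}\Lambda_{M,h}$ (Beurling-type). $\mathcal{D}_{M,h}([-1,1])$ is the space of $f\in C^\infty(\mathbb{R},\mathbb{C})$ with $\operatorname{supp} f\subseteq[-1,1]$ and $\sup_{p\in\mathbb{N},x\in\mathbb{R}}|f^{(p)}(x)|/(h^pM_p)<+\infty$; $\mathcal{D}_{\{M\}}([-1,1]):=\bigcup_{h>0}\mathcal{D}_{M,h}([-1,1])$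 and $\mathcal{D}_{(M)}([-1,1]):=\bigcap_{h>0}\mathcal{D}_{M,h}([-1,1])$. The Borel map is $\mathcal{B}(f):=(f^{(p)}(0))_{p\in\mathbb{N}}$. The first alternative before each ''resp.'' is the Roumieu case, the second the Beurling case.
   Formalization: The maximal element is claimed only if the series of 1/ν_k converges (if it diverges, e.g. N_p = p!, both sets are proved empty), and it is given by L^s only up to equivalence, since L^s itself can violate M ≤ N. *)

(* Defs.v *)
From mathcomp Require Import all_boot all_order all_algebra.
From mathcomp Require Import complex.
From mathcomp Require Import all_classical all_reals all_analysis.

Set Implicit Arguments.
Unset Strict Implicit.
Unset Printing Implicit Defensive.

Import Order.TTheory GRing.Theory Num.Theory.
Import numFieldNormedType.Exports.
Import Normc.

Local Open Scope classical_set_scope.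
Local Open Scope ring_scope.
Local Open Scope complex_scope.

Section WeightSequences.
Variable R : realType.
Implicit Types M N : nat -> R.

Definition positive_seq M : Prop := forall p, 0 < M p.

(* Real powers: [x `^ 0%:R^-1 = 1], so the index 0 is harmless in limits of
   p-th roots. *)
Definition LC N : Prop :=
  [/\ positive_seq N,
      N 0%N = 1 /\ N 0%N <= N 1%N,
      forall j, N j.+1 ^+ 2 <= N j * N j.+2 &
      (fun j => N j `^ (j%:R)^-1) @ \oo --> +oo].

Definition quotient_seq N (j : nat) : R :=
  if j is i.+1 then N i.+1 / N i else 1.

Definition preceq M N : Prop :=
  has_ubound [set (M j / N j) `^ (j%:R)^-1 | j in [set j : nat | (0 < j)%N]].

Definition equiv_seq M N : Prop := preceq M N /\ preceq N M.

(* [preceq] is only a preorder, hence maximality in the order-theoretic sense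
   reads as follows. *)
Definition maximal_elt (S : set (nat -> R)) M : Prop :=
  S M /\ forall M', S M' -> preceq M M' -> preceq M' M.

Definition Lambda_h M (h : R) : set (nat -> R[i]) :=
  [set a | has_ubound (range (fun p => normc (a p) / (h ^+ p * M p)))].

Definition Lambda_Roumieu M : set (nat -> R[i]) :=
  \bigcup_(h in [set h : R | 0 < h]) Lambda_h M h.

Definition Lambda_Beurling M : set (nat -> R[i]) :=
  \bigcap_(h in [set h : R | 0 < h]) Lambda_h M h.

(* Complex-valued functions of a real variable are differentiated
   componentwise. *)
Definition re_part (f : R -> R[i]) (x : R) : R := complex.Re (f x).
Definition im_part (f : R -> R[i]) (x : R) : R := complex.Im (f x).

Definition cderive (f : R -> R[i]) (p : nat) (x : R) : R[i] :=
  (derive1n p (re_part f) x) +i* (derive1n p (im_part f) x).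

Definition smooth (f : R -> R[i]) : Prop :=
  forall (p : nat) (x : R),
    derivable (derive1n p (re_part f)) x 1 /\ derivable (derive1n p (im_part f)) x 1.

Definition supp (f : R -> R[i]) : set R := closure [set x | f x != 0].

Definition D_h M (h : R) : set (R -> R[i]) :=
  [set f | [/\ smooth f,
               supp f `<=` [set x | -1 <= x <= 1] &
               has_ubound (range (fun px : nat * R =>
                 normc (cderive f px.1 px.2) / (h ^+ px.1 * M px.1)))]].

Definition D_Roumieu M : set (R -> R[i]) :=
  \bigcup_(h in [set h : R | 0 < h]) D_h M h.

Definition D_Beurling M : set (R -> R[i]) :=
  \bigcap_(h in [set h : R | 0 < h]) D_h M h.

Definition Borel_map (f : R -> R[i]) : nat -> R[i] := fun p => cderive f p 0.

Definition root_seq M (p : nat) : R := (M p / (p`!)%:R) `^ (p%:R)^-1.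

Definition admissible_Roumieu N : set (nat -> R) :=
  [set M | [/\ positive_seq M,
               forall p, M p <= N p,
               (0 < limn_einf (fun p => (root_seq M p)%:E))%E &
               Lambda_Roumieu M `<=` Borel_map @` D_Roumieu N]].

Definition admissible_Beurling N : set (nat -> R) :=
  [set M | [/\ positive_seq M,
               forall p, M p <= N p,
               root_seq M @ \oo --> +oo &
               Lambda_Beurling M `<=` Borel_map @` D_Beurling N]].

Definition tail_sum N (p : nat) : \bar R :=
  (\sum_(p <= k <oo) ((quotient_seq N k)^-1)%:E)%E.

(* The unit of the iterated minimum is the term of index j = 0, which belongs
   to its (nonempty) range. In [\bar R], [x / +oo = 0]: the sequence vanishes
   from index 1 on when the series of the [1 / nu_k] diverges. *)
Definition L_seq N (s p : nat) : R :=
  if p is 0 then 1 else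
  let term j := fine (p%:R%:E / tail_sum N p)%E ^+ (p - j) * N j in
  s%:R ^+ p * \big[Num.min/term 0%N]_(j < p) term j.

(* No [L_seq N s] needs to satisfy [M <= N] literally: if nu grows fast,
   [L_seq N 1 p] behaves like [p%:R * N p], and this factor [p] only disappears
   up to [equiv_seq]. So "[S] has a maximal element given by the [L^s]" means
   that [S] has an element [M] in their common equivalence class, and that [M]
   is maximal; the third clause records that it is even a largest element, i.e.
   that it is unique up to equivalence. *)
Definition has_maximal_elt_given_by
    (S : set (nat -> R)) (L : nat -> nat -> R) : Prop :=
  exists M, [/\ maximal_elt S M,
                forall s, (0 < s)%N -> equiv_seq M (L s) &
                forall M', S M' -> preceq M' M].

End WeightSequences.

(* Main.v *)
Require Import Defs.
From mathcomp Require Import all_boot all_order all_algebra.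
From mathcomp Require Import complex ring lra zify.
From mathcomp Require Import all_classical all_reals all_analysis.

Set Implicit Arguments.
Unset Strict Implicit.
Unset Printing Implicit Defensive.

Import Order.TTheory GRing.Theory Num.Theory.
Import numFieldNormedType.Exports.

Local Open Scope classical_set_scope.
Local Open Scope ring_scope.

(** Write nu_k = N_k / N_(k-1), let rho_p be the tail of the series of the
1 / nu_k from k = p on, and call slope the quotient p / rho_p: then L^1_p is the
minimum over j < p of slope_p ^ (p - j) * N_j.

Everything about functions with given flatness goes through Bang's method
([bang]). If g is flat of order n at x0 and all its derivatives obey log-convex
bounds B_k, then the derivatives stay smaller than these bounds by powers of 2,
and one factor 2 is lost on each interval of length B_(k-1) / (4 B_k). If the
series of the 1 / nu_k diverges, these lengths add up to infinity: a compactly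
supported function of the class vanishes ([quasianalytic]), so that not even the
sequence 1, 0, 0, ... is a jet, and no M is admissible.

Assume now that the series converges.

Necessity ([extension_preceq]). Let every sequence of the Beurling space of M be
a jet of the Roumieu class of N; this holds for admissible M of both types. If M
were not dominated by L^1, there would be arbitrarily large indices p with M_p
much larger than C ^ p * L^1_p. Choose a very sparse set of them and a sequence a
supported there, with a_p still much larger than L^1_p. Up to order p', the
chosen index following p, a function f realizing a has the same jet at 0 as
a_p x^p / p! plus a small polynomial of lower degree. By Bang's method this
resemblance persists up to x of the order of rho_p, and there the bounds on
f^(j) give a_p x^(p-j) / (p-j)! <= C^p N_j, hence a_p <= C^p L^1_p, a
contradiction ([spike_bound], [spike_L_seq]). Choosing one sequence in this
way replaces the usual appeal to Baire's theorem.

Sufficiency ([real_extension]). For each p a block F_p with jet 0, ..., 0, 1, 0, ...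
(the 1 at order p) is x^p / p! times a bump function which is 1 near 0 and is
supported in an interval of length comparable to rho_p. The bump comes from an
infinite convolution of uniform densities ([smooth_steps], [bump_exists]): p of
them have width rho_p / p, the others exceed 1 / nu_k by a factor that tends to
infinity with k, so that each block is even of Beurling type. The definition
of L^1 is precisely what yields |F_p^(q)| L^1_p <= A K^p 2^q N_q ([blocks]).
A sequence a is then the jet of the sum of the a_p d_p^(-p) F_p(d_p x): since
the factor d_p^(q-p) trades p against q, a bounded choice of d_p handles the
Roumieu case, and the same formula gives d_p -> 0 in the Beurling case.

As L^1_p <= 2^p N_p, the sequence L^1_p / 2^p is admissible, hence a largest
admissible element up to equivalence. *)

(** * Mean value theorem, jets and the Leibniz rule *)

Section Jets.
Variable R : realType.
Implicit Types (f g : R -> R) (F G : nat -> R -> R).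

Lemma mvt f (df : R -> R) (x y : R) : (forall z : R, is_derive z 1 f (df z)) ->
  x <= y -> exists2 c, x <= c <= y & f y - f x = df c * (y - x).
Proof.
move=> fd xy.
have [|c] := MVT_segment xy (fun z _ => fd z).
  apply: derivable_within_continuous => z _; exact: (@ex_derive _ _ _ _ _ _ _ (fd z)).
by rewrite in_itv /= => cxy ->; exists c.
Qed.

Lemma mvt_unordered f (df : R -> R) (x y : R) :
  (forall z : R, is_derive z 1 f (df z)) ->
  exists2 c, `|c - x| <= `|y - x| & f y - f x = df c * (y - x).
Proof.
move=> fd; have [xy|/ltW yx] := leP x y.
  have [c /andP[xc cy] ->] := mvt fd xy; exists c => //.
  by rewrite !ger0_norm ?subr_ge0// lerB.
have [c /andP[yc cx] e] := mvt fd yx; exists c; last by lra.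
by rewrite distrC [leRHS]distrC !ger0_norm ?subr_ge0// lerB.
Qed.

Lemma lipschitz_of_derive f (df : R -> R) C :
  (forall z : R, is_derive z 1 f (df z)) -> (forall z, `|df z| <= C) ->
  forall x y, `|f y - f x| <= C * `|y - x|.
Proof.
move=> fd dfC x y; have [c _ ->] := mvt_unordered x y fd.
by rewrite normrM ler_wpM2r.
Qed.

(** The quotient (f y - f x) / (y - x) differs from l by at most C |y - x|, so
that Caratheodory's criterion applies. *)
Lemma is_derive_quadratic f (x : R) l C :
  (forall y, `|f y - f x - l * (y - x)| <= C * (y - x) ^+ 2) ->
  is_derive x 1 f l.
Proof.
move=> fl; apply/is_derive1_caratheodory.
exists (fun z => if z == x then l else (f z - f x) / (z - x)); split.
- move=> z; case: eqP => [->|/eqP zx]; first by rewrite !subrr mulr0.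
  by rewrite divfK// subr_eq0.
- have gl z : `|l - (if z == x then l else (f z - f x) / (z - x))| <= `|C| * `|z - x|.
    case: eqP => [->|/eqP zx]; first by rewrite subrr normr0 mulr_ge0.
    have zx0 : z - x != 0 by rewrite subr_eq0.
    have -> : l - (f z - f x) / (z - x) = - ((f z - f x - l * (z - x)) / (z - x)).
      by field.
    rewrite normrN normrM normfV ler_pdivrMr ?normr_gt0//.
    apply: le_trans (fl z) _; rewrite -mulrA -normrM -expr2 ger0_norm ?sqr_ge0//.
    by rewrite ler_wpM2r ?sqr_ge0// ler_norm.
  apply/cvgrPdist_le => e e0; rewrite eqxx; near=> z.
  apply: le_trans (gl z) _.
  have C1 : 0 < `|C| + 1 by rewrite ltr_wpDl.
  apply: (@le_trans _ _ ((`|C| + 1) * `|z - x|)).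
    by rewrite ler_wpM2r// lerDl.
  rewrite mulrC -ler_pdivlMr// distrC; near: z.
  apply: (@cvgr_dist_le _ R^o R (nbhs x) _ id x cvg_id).
  by rewrite divr_gt0.
- by rewrite eqxx.
Unshelve. all: by end_near. Qed.

(** A common Lipschitz constant makes the error of the first order expansion of
f_n uniform in n, so that it survives a mere pointwise limit. *)
Lemma is_derive_limit (f_ g_ : nat -> R -> R) f g C :
  (forall n (z : R), is_derive z 1 (f_ n) (g_ n z)) ->
  (forall n x y, `|g_ n y - g_ n x| <= C * `|y - x|) ->
  (forall x, f_ n x @[n --> \oo] --> f x) ->
  (forall x, g_ n x @[n --> \oo] --> g x) ->
  forall x : R, is_derive x 1 f (g x).
Proof.
move=> fd gC ff gg x; apply: (@is_derive_quadratic _ _ _ C) => y.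
have: `|f_ n y - f_ n x - g_ n x * (y - x)| @[n --> \oo] -->
   `|f y - f x - g x * (y - x)|.
  by apply: cvg_norm; apply: cvgB; [exact: cvgB|exact: cvgMr_tmp].
move/cvgr_to_le; apply; near=> n.
have [c cx ->] := mvt_unordered x y (fd n).
rewrite -mulrBl normrM.
apply: (@le_trans _ _ (C * `|c - x| * `|y - x|)); first by rewrite ler_wpM2r.
have C0 : 0 <= C.
  by have := le_trans (normr_ge0 _) (gC 0%N 0 1); rewrite subr0 normr1 mulr1.
rewrite -(real_normK (num_real (y - x))) expr2 mulrA.
by rewrite ler_wpM2r// ler_wpM2l.
Unshelve. all: by end_near. Qed.

(** The derivatives are carried along as explicit functions, because all
estimates bear on formulas for them; iterated derivatives of one function are
recovered by [jet_derive1n]. *)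
Definition jet F := forall q (x : R), is_derive x 1 (F q) (F q.+1 x).

Lemma jet_derive1n F : jet F -> forall q, derive1n q (F 0%N) = F q.
Proof.
move=> jF; elim=> [//|q IH]; rewrite derive1nS IH; apply/funext => x.
by rewrite derive1E; have [_ ->] := jF q x.
Qed.

Lemma jet_of_smooth f : (forall p x, derivable (derive1n p f) x 1) ->
  jet (fun p => derive1n p f).
Proof. by move=> fs q x; rewrite derive1nS derive1E; apply/derivableP/fs. Qed.

Lemma jetB F G : jet F -> jet G -> jet (fun q x => F q x - G q x).
Proof. by move=> jF jG q x; apply: is_deriveB. Qed.

Lemma jetD F G : jet F -> jet G -> jet (fun q x => F q x + G q x).
Proof. by move=> jF jG q x; apply: is_deriveD. Qed.

Lemma jetZ a F : jet F -> jet (fun q x => a * F q x).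
Proof. by move=> jF q x; apply: is_deriveZ. Qed.

Lemma jet0 : jet (fun _ _ => 0).
Proof. by move=> q x; apply: is_derive_cst. Qed.

Lemma jet_sum n (F : nat -> nat -> R -> R) : (forall i, jet (F i)) ->
  jet (fun q x => \sum_(i < n) F i q x).
Proof.
move=> jF; elim: n => [|n IH].
  by under eq_fun do (under eq_fun do rewrite big_ord0); exact: jet0.
under eq_fun do (under eq_fun do rewrite big_ord_recr/=).
exact: jetD.
Qed.

Lemma is_derive_affine f (l a b x : R) : is_derive (a * x + b) 1 f l ->
  is_derive x 1 (fun x => f (a * x + b)) (l * a).
Proof.
move=> fl; apply: (@is_derive1_comp _ f (fun x => a * x + b)) => //.
have -> : (fun x => a * x + b) = (a \*: @id R) + cst b by [].
apply: is_derive_eq.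
by rewrite addr0 /GRing.scale/= mulr1.
Qed.

Lemma jet_affine F (a b : R) : jet F ->
  jet (fun q x => a ^+ q * F q (a * x + b)).
Proof.
move=> jF q x; apply: is_derive_eq.
  by apply: is_deriveZ; apply: is_derive_affine; exact: jF.
by rewrite /GRing.scale/= exprSr; ring.
Qed.

(** The q-th derivative of x^p / p!. The test on q matters: truncated subtraction
would turn the zero derivatives into the constant 1. *)
Definition monomial p q (x : R) : R :=
  if (q <= p)%N then x ^+ (p - q) / (p - q)`!%:R else 0.

Lemma jet_monomial p : jet (monomial p).
Proof.
move=> q x; rewrite /monomial; case: (ltngtP q p) => [qp|pq|->] /=; last 2 first.
- exact: is_derive_cst.
- rewrite subnn; under eq_fun do rewrite expr0.
  exact: is_derive_cst.
rewrite subnS; have : (0 < p - q)%N by rewrite subn_gt0.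
case: (p - q)%N => // m _ /=.
have -> : (fun x : R => x ^+ m.+1 / m.+1`!%:R) = (m.+1`!%:R^-1 : R) \*: (@id R ^+ m.+1).
  by apply/funext => z; rewrite /= mulrC fctE.
apply: is_derive_eq.
rewrite /GRing.scale/= mulr1 factS natrM invfM.
have : (m.+1%:R : R) != 0 by [].
have : (m`!%:R : R) != 0 by rewrite pnatr_eq0 -lt0n fact_gt0.
by move=> *; field; apply/andP.
Qed.

Lemma jetM F G : jet F -> jet G ->
  jet (fun q x => \sum_(i < q.+1) 'C(q, i)%:R * (F i x * G (q - i)%N x)).
Proof.
move=> jF jG q x.
have -> : (fun x => \sum_(i < q.+1) 'C(q, i)%:R * (F i x * G (q - i)%N x)) =
   \sum_(i < q.+1) (('C(q, i)%:R : R) \*: (F i * G (q - i)%N)).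
  by apply/funext => z; rewrite fct_sumE.
apply: is_derive_eq.
  apply: is_derive_sum => i; apply: is_deriveZ; apply: is_deriveM; [exact: jF|exact: jG].
transitivity (\sum_(i < q.+1) 'C(q, i)%:R * (F i x * G (q.+1 - i)%N x) +
    \sum_(i < q.+1) 'C(q, i)%:R * (F i.+1 x * G (q.+1 - i.+1)%N x)).
  rewrite -big_split/=; apply: eq_bigr => i _.
  by rewrite /GRing.scale/= subSS subSn ?leq_ord//; ring.
rewrite [RHS]big_ord_recl/= bin0 [X in X + _ = _]big_ord_recl/= bin0 -!addrA.
congr (_ + _).
rewrite [X in _ + X = _]big_ord_recr/= [RHS]big_ord_recr/= !binn addrA.
congr (_ + _); rewrite -big_split/=.
by apply: eq_bigr => i _; rewrite /bump/= add1n binS natrD; ring.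
Qed.

(** Taylor's formula without its factorials follows from the mean value theorem
by induction on the order; the geometric sums of [bang_step] absorb the loss. *)
Lemma taylor F (x0 : R) (m j : nat) (y C : R) : jet F -> x0 <= y ->
  (forall z, x0 <= z <= y -> `|F (j + m)%N z| <= C) ->
  `|F j y| <= \sum_(i < m) `|F (j + i)%N x0| * (y - x0) ^+ i + C * (y - x0) ^+ m.
Proof.
move=> jF; elim: m j y => [|m IH] j y xy FC.
  by rewrite big_ord0 add0r mulr1; move: (FC y); rewrite addn0 lexx xy; apply.
have [c /andP[xc cy] e] := mvt (jF j) xy.
have -> : F j y = F j x0 + F j.+1 c * (y - x0) by rewrite -e; ring.
apply: le_trans (ler_normD _ _) _.
rewrite big_ord_recl/= addn0 expr0 mulr1 -addrA lerD2l normrM (ger0_norm (x := y - x0)) ?subr_ge0//.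
under eq_bigr do rewrite /bump/= add1n exprSr mulrA -addSnnS.
rewrite exprSr mulrA -mulr_suml -mulrDl ler_wpM2r ?subr_ge0//.
apply: le_trans (IH j.+1 c xc _) _.
  move=> z /andP[xz zc]; rewrite addSnnS; apply: FC; rewrite xz/=; exact: le_trans cy.
apply: lerD.
  apply: ler_sum => i _; rewrite ler_wpM2l// lerXn2r ?nnegrE ?subr_ge0//.
  by rewrite lerB.
rewrite ler_wpM2l// ?lerXn2r ?nnegrE ?subr_ge0 ?lerB//.
by apply: le_trans (FC x0 _); rewrite ?lexx.
Qed.

End Jets.

(** * Bang's estimate for flat functions *)

Section Bang.
Variable R : realType.
Implicit Types (F : nat -> R -> R) (B N : nat -> R).

Definition log_convex B : Prop :=
  (forall k, 0 < B k) /\ forall k, B k.+1 ^+ 2 <= B k * B k.+2.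

Lemma log_convex_ratio B (l k : nat) : log_convex B -> (l <= k)%N ->
  B l.+1 / B l <= B k.+1 / B k.
Proof.
move=> [B0 Blc] /subnKC <-; elim: (k - l)%N => [|m IH]; first by rewrite addn0.
apply: le_trans IH _; rewrite addnS ler_pdivrMr// mulrAC ler_pdivlMr//.
by rewrite mulrC -expr2 mulrC.
Qed.

(** The quotients B_(l+1) / B_l increase, so the smallness of h compared with the
k-th one controls all the previous ones. *)
Lemma log_convex_growth B (h : R) (k j i : nat) : log_convex B -> 0 <= h ->
  4 * h * B k.+1 <= B k -> (j + i <= k.+1)%N -> B (j + i)%N * (4 * h) ^+ i <= B j.
Proof.
move=> lB h0 hk; have [B0 _] := lB.
elim: i => [|i IH]; first by rewrite addn0 mulr1.
rewrite addnS => ji; apply: le_trans (IH (ltnW ji)).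
rewrite exprSr mulrA mulrAC ler_wpM2r ?exprn_ge0 ?mulr_ge0//.
have := log_convex_ratio lB (ji : (j + i <= k)%N).
rewrite ler_pdivrMr// mulrAC ler_pdivlMr// => r.
rewrite -(ler_pM2r (B0 k)) mulrAC.
apply: le_trans (_ : B k.+1 * B (j + i)%N * (4 * h) <= _).
  by rewrite ler_wpM2r ?mulr_ge0.
by rewrite mulrAC mulrC ler_wpM2l ?(ltW (B0 _))// mulrC.
Qed.

Lemma geometric_le2 m : \sum_(i < m) (2^-1 : R) ^+ i + 2^-1 ^+ m <= 2.
Proof.
suff -> : \sum_(i < m) (2^-1 : R) ^+ i = 2 - 2 * 2^-1 ^+ m.
  have : 0 <= (2^-1 : R) ^+ m by rewrite exprn_ge0.
  lra.
elim: m => [|m IH]; first by rewrite big_ord0 mulr1 subrr.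
by rewrite big_ord_recr/= IH exprS; field.
Qed.

(** Assume that at x the derivatives of order j <= k beat the bounds B_j by the
factors 2^(k+1-j). In the Taylor sum at y, log-convexity and y - x <=
B_k / (4 B_(k+1)) bound the i-th term by 2^-i times the bound of the first one.
The sum is at most twice the latter: the move from x to y costs one factor 2. *)
Lemma bang_step F B (k : nat) (x y : R) : jet F -> log_convex B -> x <= y ->
  4 * (y - x) * B k.+1 <= B k ->
  (forall z, x <= z <= y -> `|F k.+1 z| <= B k.+1) ->
  (forall j, (j <= k)%N -> 2 ^+ k.+1 * `|F j x| <= 2 ^+ j * B j) ->
  forall j, (j <= k)%N -> 2 ^+ k * `|F j y| <= 2 ^+ j * B j.
Proof.
move=> jF lB xy hk FB Fx j jk; have [B0 _] := lB.
set h := y - x in hk *; have h0 : 0 <= h by rewrite subr_ge0.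
set m := (k.+1 - j)%N; have jm : (j + m)%N = k.+1 by rewrite subnKC// ltnW.
have := @taylor R F x m j y (B k.+1) jF xy; rewrite jm => /(_ FB).
rewrite -/h => Fy.
have two0 n : 0 < (2 : R) ^+ n by rewrite exprn_gt0.
have g i : (j + i <= k.+1)%N -> 2 ^+ i * h ^+ i * B (j + i)%N <= B j * 2^-1 ^+ i.
  move=> ji; have := log_convex_growth lB h0 hk ji.
  rewrite exprVn ler_pdivlMr//; apply: le_trans.
  rewrite (_ : 4 = 2 * 2 :> R); last by ring.
  by rewrite !exprMn le_eqVlt; apply/orP; left; apply/eqP; ring.
rewrite -(ler_pM2l (two0 1%N)) mulrA -exprD add1n.
apply: (@le_trans _ _ (2 ^+ j * B j * (\sum_(i < m) (2^-1 : R) ^+ i + 2^-1 ^+ m))); last first.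
  by rewrite expr1 mulrC ler_wpM2r ?geometric_le2// mulr_ge0 1?ltW.
apply: le_trans (ler_wpM2l (ltW (two0 _)) Fy) _.
rewrite !mulrDr !mulr_sumr; apply: lerD.
  apply: ler_sum => i _; have ji : (j + i < k.+1)%N by rewrite -jm ltn_add2l.
  rewrite mulrA; apply: le_trans (ler_wpM2r (exprn_ge0 _ h0) (Fx _ ji)) _.
  rewrite exprD -!mulrA ler_wpM2l ?(ltW (two0 _))//.
  by apply: le_trans (g _ (ltnW ji)); rewrite le_eqVlt; apply/orP; left; apply/eqP; ring.
rewrite -jm exprD -!mulrA ler_wpM2l ?(ltW (two0 _))//.
by apply: le_trans (g m _); rewrite jm// le_eqVlt; apply/orP; left; apply/eqP; ring.
Qed.

(** Bang's method. Flatness of order n at x0 beats the bounds by 2^n, and the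
successive moves of [bang_step], for k = n - 1 down to p, each lose a factor 2
while advancing by B_k / (4 B_(k+1)). *)
Lemma bang F B (x0 y : R) (p n : nat) : jet F -> log_convex B ->
  (forall k z, (k <= n)%N -> x0 <= z <= y -> `|F k z| <= B k) ->
  (forall k, (k < n)%N -> F k x0 = 0) -> (p <= n)%N ->
  x0 <= y -> y <= x0 + \sum_(p <= k < n) B k / (4 * B k.+1) ->
  forall j, (j <= p)%N -> 2 ^+ p * `|F j y| <= 2 ^+ j * B j.
Proof.
move=> jF lB + F0 pn; have [B0 _] := lB.
rewrite -(subKn pn); move: (leq_subr p n); move: (n - p)%N => d.
elim: d y => [|d IH] y dn FB x0y yx0 j jp.
  move: jp yx0; rewrite subn0 big_geq// addr0 => jn yx.
  have {yx}yx : y = x0 by apply/eqP; rewrite eq_le yx.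
  move: jn; rewrite leq_eqVlt => /predU1P[->|jn].
    by rewrite ler_wpM2l ?exprn_ge0// FB ?lexx// yx lexx.
  by rewrite yx F0// normr0 mulr0 mulr_ge0 ?exprn_ge0// ltW.
have ndS : (n - d)%N = (n - d.+1).+1 by rewrite subnSK.
set s := \sum_((n - d) <= k < n) B k / (4 * B k.+1).
have s0 : 0 <= s by apply: sumr_ge0 => k _; rewrite divr_ge0 ?mulr_ge0// ltW.
have {}yx0 : y <= x0 + s + B (n - d.+1)%N / (4 * B (n - d)%N).
  apply: le_trans yx0 _; rewrite big_ltn; last by rewrite ltn_subrL/=; lia.
  by rewrite -ndS -/s; lra.
have [yxs|/ltW xsy] := leP y (x0 + s).
  have jp' : (j <= n - d)%N by rewrite ndS leqW.
  apply: le_trans (IH y (ltnW dn) FB x0y yxs j jp').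
  by rewrite ler_wpM2r// ler_weXn2l ?ler1n// ndS.
apply: (@bang_step F B _ (x0 + s) y) => //.
- rewrite -ndS -ler_pdivlMr// mulrC -ler_pdivlMr// -mulrA -invfM [B _ * 4]mulrC.
  by move: yx0; rewrite -lerBlDl => /le_trans; apply.
- move=> z /andP[z1 z2]; rewrite -ndS FB ?leq_subr// z2 andbT.
  by apply: le_trans z1; rewrite lerDl.
- move=> i ip; rewrite -ndS; apply: IH; rewrite ?(ltnW dn) ?lerDl//.
    move=> k z kn /andP[z1 z2]; apply: FB => //; rewrite z1/=; exact: le_trans xsy.
  by rewrite ndS leqW.
Qed.

End Bang.

(** * Quotients, tails and the sequence L *)

Section Weights.
Variables (R : realType) (N : nat -> R).
Hypothesis HN : LC N.
Let nu := quotient_seq N.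

Lemma LC_log_convex : log_convex N.
Proof. by have [N0 _ Nlc _] := HN. Qed.

Lemma LC_gt0 p : 0 < N p. Proof. by have [+ _ _ _] := HN. Qed.

Lemma LC0 : N 0 = 1. Proof. by have [_ [] ] := HN. Qed.

Lemma quotient_gt0 p : 0 < quotient_seq N p.
Proof. by case: p => [|p]//=; rewrite divr_gt0 ?LC_gt0. Qed.

Lemma quotient_le (k l : nat) : (0 < k <= l)%N -> quotient_seq N k <= quotient_seq N l.
Proof. by case: k l => [|k] [|l]//= kl; exact: log_convex_ratio LC_log_convex _. Qed.

Lemma quotient_ge1 k : 1 <= quotient_seq N k.
Proof.
case: k => [|k]//; apply: le_trans (@quotient_le 1 k.+1 isT).
by have [_ [N0 N1] _ _] := HN; rewrite /= N0 divr1 -N0.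
Qed.

Lemma LC_succ p : N p.+1 = quotient_seq N p.+1 * N p.
Proof. by rewrite /= divfK// gt_eqF ?LC_gt0. Qed.

Lemma LC_le (j k : nat) : (j <= k)%N -> N j <= N k.
Proof.
move=> /subnKC <-; elim: (k - j)%N => [|m]; first by rewrite addn0.
move=> /le_trans; apply; rewrite addnS LC_succ.
by rewrite ler_peMl ?quotient_ge1// ltW// LC_gt0.
Qed.

Lemma LC_ge1 p : 1 <= N p. Proof. by rewrite -LC0 LC_le. Qed.

Lemma LC_le_quotientX (j d : nat) : N (j + d)%N <= quotient_seq N (j + d)%N ^+ d * N j.
Proof.
elim: d => [|d IH]; first by rewrite addn0 mul1r.
rewrite addnS LC_succ exprS -mulrA ler_wpM2l ?(ltW (quotient_gt0 _))//.
apply: le_trans IH _; rewrite ler_wpM2r ?(ltW (LC_gt0 _))//.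
case: d => [|d]; first by rewrite !expr0.
rewrite lerXn2r ?nnegrE ?(ltW (quotient_gt0 _))//.
by apply: quotient_le; rewrite addnS/=.
Qed.

Definition rho (p : nat) : R := fine (tail_sum N p).

Local Lemma inv_quotient_ge0 k : (0 <= ((quotient_seq N k)^-1)%:E)%E.
Proof. by rewrite lee_fin invr_ge0 ltW// quotient_gt0. Qed.

Lemma tail_sum_recl p : tail_sum N p = ((quotient_seq N p)^-1%:E + tail_sum N p.+1)%E.
Proof.
rewrite /tail_sum (@nneseries_split _ _ p 1); last by move=> *; exact: inv_quotient_ge0.
by rewrite addn1 big_nat1.
Qed.

Lemma tail_sum_ge0 p : (0 <= tail_sum N p)%E.
Proof. by apply: nneseries_ge0 => k _ _; exact: inv_quotient_ge0. Qed.

Lemma tail_sum_partial (A : R) : tail_sum N 1 = +oo%E ->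
  exists n, A <= \sum_(1 <= k < n) (quotient_seq N k)^-1.
Proof.
move=> Noo; apply: contrapT => /forallNP An.
suff : (tail_sum N 1 <= A%:E)%E by rewrite Noo leye_eq.
apply: lime_le; first by apply: is_cvg_nneseries => k _ _; exact: inv_quotient_ge0.
near=> n; rewrite sumEFin lee_fin; apply/ltW; rewrite ltNge; exact/negP/An.
Unshelve. all: by end_near. Qed.

Hypothesis Nfin : (tail_sum N 1 < +oo)%E.

Lemma tail_sum_fin p : tail_sum N p \is a fin_num.
Proof.
rewrite ge0_fin_numE ?tail_sum_ge0//; elim: p => [|[|p] IH]//.
  by rewrite tail_sum_recl lte_add_pinfty// ltry.
by move: IH; rewrite tail_sum_recl; apply: le_lt_trans; rewrite leeDr ?inv_quotient_ge0.
Qed.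

Lemma rhoE p : tail_sum N p = (rho p)%:E.
Proof. by rewrite /rho fineK ?tail_sum_fin. Qed.

Lemma rho_recl p : rho p = (quotient_seq N p)^-1 + rho p.+1.
Proof. by rewrite {1}/rho tail_sum_recl rhoE. Qed.

Lemma rho_gt0 p : 0 < rho p.
Proof.
rewrite rho_recl ltr_pwDl ?invr_gt0 ?quotient_gt0//.
by rewrite -lee_fin -rhoE tail_sum_ge0.
Qed.

Lemma rho_split (p n : nat) : (p <= n)%N ->
  rho p = \sum_(p <= k < n) (quotient_seq N k)^-1 + rho n.
Proof.
move=> /subnKC <-; elim: (n - p)%N => [|m IH]; first by rewrite addn0 big_geq// add0r.
by rewrite addnS big_nat_recr ?leq_addr//= -addrA -rho_recl.
Qed.

Lemma rho_le (p n : nat) : (p <= n)%N -> rho n <= rho p.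
Proof.
move=> pn; rewrite (rho_split pn) lerDr sumr_ge0// => k _.
by rewrite invr_ge0 ltW// quotient_gt0.
Qed.

Lemma rho_cvg0 : rho p @[p --> \oo] --> (0 : R).
Proof.
suff : (tail_sum N p @[p --> \oo] --> 0%E) by move/fine_cvg.
apply: nneseries_tail_cvg => [|k _]; last exact: inv_quotient_ge0.
by rewrite -[X in (X < _)%E]/(tail_sum N 0) rhoE ltry.
Qed.

Lemma rho_small (e : R) : 0 < e -> exists P, forall p, (P <= p)%N -> rho p <= e.
Proof.
move=> e0; have /cvgrPdist_le/(_ e e0)[P _ PH] := rho_cvg0.
by exists P => p /PH /=; rewrite sub0r normrN ger0_norm// ltW// rho_gt0.
Qed.

(** The quotient is sealed, so that sign lemmas about products treat slopes as
atoms. *)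
Definition slope (p : nat) : R := locked (p%:R / rho p).

Lemma slope_def p : slope p = p%:R / rho p. Proof. by rewrite /slope -lock. Qed.

Lemma slope_ge0 p : 0 <= slope p.
Proof. by rewrite slope_def divr_ge0 ?ler0n// ltW// rho_gt0. Qed.

Lemma slope_gt0 p : (0 < p)%N -> 0 < slope p.
Proof. by move=> p0; rewrite slope_def divr_gt0 ?ltr0n// rho_gt0. Qed.

Lemma slopeE p : fine (p%:R%:E / tail_sum N p)%E = slope p.
Proof. by rewrite slope_def rhoE inver gt_eqF ?rho_gt0// -EFinM. Qed.

Lemma L_seqE s p : (0 < p)%N -> L_seq N s p = s%:R ^+ p * L_seq N 1 p.
Proof. by case: p => // p _; rewrite /L_seq expr1n mul1r. Qed.

Lemma L_seq_le (p j : nat) : (j < p)%N -> L_seq N 1 p <= slope p ^+ (p - j) * N j.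
Proof.
case: p => // p jp; rewrite /L_seq expr1n mul1r slopeE.
exact: (bigmin_le_cond _ (j := Ordinal jp)).
Qed.

Lemma le_L_seq (p : nat) (x : R) : (0 < p)%N ->
  (forall j, (j < p)%N -> x <= slope p ^+ (p - j) * N j) -> x <= L_seq N 1 p.
Proof.
case: p => // p _ xj; rewrite /L_seq expr1n mul1r slopeE.
by apply: le_bigmin => [|i _]; exact: xj.
Qed.

Lemma L_seq_gt0 p : 0 < L_seq N 1 p.
Proof.
case: p => [|p]; first exact: ltr01.
rewrite /L_seq expr1n mul1r slopeE; apply: lt_bigmin => [|i _];
  by rewrite mulr_gt0 ?exprn_gt0 ?slope_gt0 ?LC_gt0.
Qed.

(** The term of index p - 1 is at most p N_p, because rho_p >= 1 / nu_p. The
factor p is the reason why L^1 need not be below N. *)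
Lemma L_seq_le_weight p : L_seq N 1 p <= 2 ^+ p * N p.
Proof.
case: p => [|p]; first by rewrite LC0 mulr1.
apply: le_trans (L_seq_le (ltnSn p)) _.
rewrite LC_succ mulrA ler_wpM2r ?(ltW (LC_gt0 _))// subSnn expr1.
rewrite slope_def ler_pM ?invr_ge0 ?(ltW (rho_gt0 _))//.
  by rewrite -natrX ler_nat ltnW// ltn_expl.
rewrite -[leRHS]invrK lef_pV2 ?posrE ?invr_gt0 ?quotient_gt0 ?rho_gt0//.
by rewrite rho_recl lerDl ltW// rho_gt0.
Qed.

End Weights.

(** * The preorder of weight sequences *)

Section Roots.
Variable R : realType.
Implicit Types M L : nat -> R.

Lemma powR_root_ler (x y : R) (p : nat) : 0 <= x -> 0 <= y -> (0 < p)%N ->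
  (x `^ (p%:R)^-1 <= y) = (x <= y ^+ p).
Proof.
move=> x0 y0 p0; rewrite -(ler_pXn2r p0) ?nnegrE ?powR_ge0//.
rewrite -[X in X <= _]powR_mulrn ?powR_ge0// -powRrM mulVf ?powRr1//.
by rewrite pnatr_eq0 -lt0n.
Qed.

Lemma preceqP M L : positive_seq M -> positive_seq L ->
  preceq M L <-> exists2 C, 0 < C & forall p, (0 < p)%N -> M p <= C ^+ p * L p.
Proof.
move=> M0 L0; have ML p : 0 <= M p / L p by rewrite divr_ge0 ?ltW.
split=> [[C CP]|[C C0 CP]].
  have C0 : 0 <= C by apply: le_trans (CP _ (ex_intro2 _ _ 1%N isT erefl)); exact: powR_ge0.
  exists (C + 1) => [|p p0]; first by rewrite ltr_wpDl.
  rewrite -ler_pdivrMr//.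
  apply: le_trans (_ : C ^+ p <= _); last by rewrite lerXn2r ?nnegrE ?addr_ge0// lerDl.
  by rewrite -powR_root_ler//; apply: CP; exists p.
exists C => _ [p /= p0 <-].
by rewrite powR_root_ler ?(ltW C0)// ler_pdivrMr// CP.
Qed.

(** Finitely many indices cannot prevent domination, so a failure recurs at
arbitrarily large indices, whatever the constant. *)
Lemma not_preceq M L : positive_seq M -> positive_seq L -> ~ preceq M L ->
  forall (C : R) (P : nat), exists2 p, (P < p)%N & C ^+ p * L p < M p.
Proof.
move=> M0 L0 nML C P; apply: contrapT => /forall2NP CP; apply: nML.
apply/(preceqP M0 L0).
exists (1 + `|C| + \sum_(p < P.+1) M p / L p) => [|p p0].
  by rewrite ltr_wpDr ?ltr_wpDr// sumr_ge0// => i _; rewrite divr_ge0 ?ltW.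
rewrite -ler_pdivrMr//.
have S0 : 0 <= \sum_(p < P.+1) M p / L p.
  by rewrite sumr_ge0// => i _; rewrite divr_ge0 ?ltW.
have [Pp|pP] := ltnP P p.
  apply: (@le_trans _ _ (`|C| ^+ p)); last first.
    by rewrite lerXn2r ?nnegrE ?addr_ge0//; move: S0 (normr_ge0 C); lra.
  case: (CP p) => [//|/negP]; rewrite -leNgt -ler_pdivrMr// => /le_trans; apply.
  by rewrite -normrX ler_norm.
have pP1 : (p < P.+1)%N by [].
apply: (@le_trans _ _ (1 + `|C| + \sum_(p < P.+1) M p / L p)).
  rewrite (bigD1 (Ordinal pP1))//= addrCA lerDl addr_ge0//.
  by rewrite sumr_ge0// => i _; rewrite divr_ge0 ?ltW.
by rewrite ler_eXnr//; move: S0 (normr_ge0 C); lra.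
Qed.

Lemma fact_le_expn (m p : nat) : (m <= p)%N -> (m`! <= p ^ m)%N.
Proof.
elim: m => // m IH mp; rewrite factS expnS leq_mul// IH//; exact: ltnW.
Qed.

End Roots.

(** * Isolated large entries of a jet *)

Section Peak.
Variables (R : realType).

Lemma monomial0 p q : monomial p q (0 : R) = (q == p)%:R.
Proof.
rewrite /monomial; case: ltngtP => [qp|//|->]; last by rewrite subnn divr1.
by rewrite expr0n subn_eq0 leqNgt qp mul0r.
Qed.

Lemma monomial_ge0 p q (x : R) : 0 <= x -> 0 <= monomial p q x.
Proof. by move=> x0; rewrite /monomial; case: ifP => // _; rewrite divr_ge0 ?exprn_ge0. Qed.

Lemma monomial_le p q (x y : R) : 0 <= x <= y -> monomial p q x <= monomial p q y.
Proof.
move=> /andP[x0 xy]; rewrite /monomial; case: ifP => // _.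
by rewrite ler_wpM2r ?invr_ge0// lerXn2r ?nnegrE// (le_trans x0).
Qed.

Lemma monomial_le1 p q (x : R) : 0 <= x <= 1 -> monomial p q x <= 1.
Proof.
move=> /monomial_le/le_trans; apply; rewrite /monomial; case: ifP => // _.
by rewrite expr1n mul1r invf_le1 ?ltr0n ?fact_gt0// ler1n fact_gt0.
Qed.

Lemma log_convexZ (N : nat -> R) (A h : R) : log_convex N -> 0 < A -> 0 < h ->
  log_convex (fun k => A * (h ^+ k * N k)).
Proof.
move=> [N0 Nlc] A0 h0; split=> k; first by rewrite !mulr_gt0 ?exprn_gt0.
rewrite (_ : _ ^+ 2 = (A ^+ 2 * h ^+ k.+1 ^+ 2) * N k.+1 ^+ 2); last by ring.
rewrite [leRHS](_ : _ = (A ^+ 2 * h ^+ k.+1 ^+ 2) * (N k * N k.+2)); last by rewrite !exprS; ring.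
by rewrite ler_wpM2l ?Nlc// mulr_ge0 ?sqr_ge0.
Qed.

(** The jet of F at 0 is, up to order n, that of T plus a spike a at order p. Let l
be the largest ratio of a d^(p-j) / (p-j)! to the bound A h^j N_j, reached at
j = i. The difference g of F and of T + a x^p / p! is flat of order n and obeys
the bounds multiplied by 2 + l, so [bang] halves its i-th derivative at d:
l <= 1 + 1 + (2 + l) / 2 in units of the i-th bound, hence l <= 6. *)
Lemma spike_bound (N : nat -> R) (F T : nat -> R -> R) (A h a d : R) (p n : nat) :
  log_convex N -> jet F -> jet T -> 0 < A -> 0 < h -> 0 <= a -> 0 <= d -> (p < n)%N ->
  (forall q x, 0 <= x <= d -> `|F q x| <= A * (h ^+ q * N q)) ->
  (forall q x, 0 <= x <= d -> `|T q x| <= A * (h ^+ q * N q)) ->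
  (forall q, (q < n)%N -> F q 0 = T q 0 + (q == p)%:R * a) ->
  d <= (4 * h)^-1 * \sum_(p <= k < n) N k / N k.+1 ->
  forall j, (j < p)%N -> a * monomial p j d <= 6 * (A * (h ^+ j * N j)).
Proof.
move=> lN jF jT A0 h0 a0 d0 pn FA TA F0 dn j jp.
have [N0 _] := lN.
pose B k := A * (h ^+ k * N k).
have B0 k : 0 < B k by rewrite !mulr_gt0 ?exprn_gt0.
pose r (i : 'I_p) := a * monomial p i d / B i.
(* i is the order of differentiation at which the spike is most visible *)
have [i _ /(_ _ isT) ri] := @arg_maxP _ _ _ (Ordinal jp) predT r isT.
set l := r i in ri.
suff l6 : l <= 6.
  by rewrite -ler_pdivrMr ?B0//; apply: le_trans l6; exact: (ri (Ordinal jp)).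
rewrite leNgt; apply/negP => l6.
have l2 : 0 < 2 + l by lra.
pose g q x := F q x - (T q x + a * monomial p q x).
have jg : jet g by apply: jetB => //; apply: jetD => //; apply: jetZ; exact: jet_monomial.
have sp k x : 0 <= x <= d -> a * monomial p k x <= l * B k.
  move=> xd; apply: (@le_trans _ _ (a * monomial p k d)).
    by rewrite ler_wpM2l// monomial_le.
  have [kp|pk|kp] := ltngtP k p.
  - by rewrite -ler_pdivrMr//; exact: (ri (Ordinal kp)).
  - by rewrite /monomial leqNgt pk mulr0 mulr_ge0// ltW//; lra.
  - rewrite kp /monomial leqnn subnn divr1 mulr1.
    have Fp := F0 p pn; rewrite eqxx mul1r in Fp.
    have -> : a = F p 0 - T p 0 by rewrite Fp; ring.
    have o0 : 0 <= (0 : R) <= d by rewrite lexx.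
    apply: le_trans (ler_norm _) _; apply: le_trans (ler_normB _ _) _.
    apply: le_trans (lerD (FA p 0 o0) (TA p 0 o0)) _.
    by rewrite -/(B p) -mulr2n -mulr_natl ler_wpM2r ?(ltW (B0 _))//; lra.
have lB := log_convexZ lN (mulr_gt0 l2 A0) h0.
have BE k : (2 + l) * A * (h ^+ k * N k) = (2 + l) * B k by rewrite /B -mulrA.
have : 2 ^+ p * `|g i d| <= 2 ^+ i * ((2 + l) * B i).
  rewrite -BE; apply: (bang jg lB _ _ (ltnW pn) d0 _ (ltnW (ltn_ord i))).
  - move=> k z kn zd; rewrite BE mulrDl mulr_natl mulr2n -addrA.
    apply: le_trans (ler_normB _ _) _; apply: lerD; first exact: FA.
    apply: le_trans (ler_normD _ _) _; apply: lerD; first exact: TA.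
    rewrite ger0_norm ?sp// mulr_ge0// monomial_ge0//.
    by case/andP: zd.
  - by move=> k kn; rewrite /g F0// monomial0; ring.
  - rewrite add0r; apply: le_trans dn _; rewrite mulr_sumr ler_sum// => k _.
    rewrite le_eqVlt; apply/orP; left; apply/eqP; rewrite exprS.
    have := N0 k; have := N0 k.+1; have : 0 < h ^+ k by rewrite exprn_gt0.
    move=> /gt_eqF h1 /gt_eqF h2 /gt_eqF h3.
    by field; rewrite h2 h1 !gt_eqF.
have -> : (2 : R) ^+ p = 2 ^+ i * 2 ^+ (p - i).
  by rewrite -exprD subnKC// ltnW.
rewrite -mulrA ler_pM2l ?exprn_gt0// => gi.
have : 2 * `|g i d| <= (2 + l) * B i.
  apply: le_trans gi; rewrite ler_wpM2r// -[leLHS]expr1.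
  by rewrite ler_weXn2l ?ler1n// subn_gt0.
have dd : 0 <= d <= d by rewrite d0 lexx.
have := FA i d dd; have := TA i d dd; rewrite -/(B i) => Td Fd gd.
have lE : l * B i = a * monomial p i d by rewrite /l /r divfK// gt_eqF.
have : l * B i <= `|F i d| + `|T i d| + `|g i d|.
  rewrite lE (_ : _ * _ = F i d - T i d - g i d); last by rewrite /g; ring.
  apply: le_trans (ler_norm _) _; apply: le_trans (ler_normB _ _) _.
  by rewrite lerD2r ler_normB.
have := B0 i; nra.
Qed.

End Peak.

(** * Quasianalytic classes *)

Section ComplexValues.
Variable R : realType.
Implicit Types (N M : nat -> R).

Lemma normc_Re_le (z : R[i]) : `|complex.Re z| <= Normc.normc z.
Proof.
case: z => a b /=; rewrite -sqrtr_sqr ler_wsqrtr// lerDl sqr_ge0 //.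
Qed.

Lemma normc_le_ReIm (z : R[i]) : Normc.normc z <= `|complex.Re z| + `|complex.Im z|.
Proof.
case: z => a b /=; rewrite -[leRHS]ger0_norm ?addr_ge0// -sqrtr_sqr ler_wsqrtr//.
rewrite sqrrD !real_normK ?num_real//.
have : 0 <= `|a| * `|b| by rewrite mulr_ge0.
lra.
Qed.

(** Local vanishing passes from each derivative to the next one. *)
Lemma jet_eq0 (F : nat -> R -> R) (A : set R) : open A -> jet F ->
  (forall x, A x -> F 0 x = 0) -> forall p x, A x -> F p x = 0.
Proof.
move=> oA jF F0; elim=> [//|p IH] x Ax.
have [_ <-] := jF p x.
have : is_derive x 1 (F p) 0.
  apply: near_eq_is_derive (is_derive_cst (0 : R) x 1).
  have : nbhs x A by apply: open_nbhs_nbhs.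
  by apply: filterS => z /IH ->.
by case.
Qed.

(** The prescribed jets used to test admissibility are real, so that the real
part of the function carries all the information. *)
Lemma D_h_jet N (h : R) (f : R -> R[i]) : positive_seq N -> 0 < h -> D_h N h f ->
  exists2 F, jet F & exists C, [/\ 0 < C,
    forall p x, `|F p x| <= C * (h ^+ p * N p),
    forall p x, x < -1 -> F p x = 0 &
    forall p, F p 0 = complex.Re (Borel_map f p)].
Proof.
move=> N0 h0 [fs fsupp [C fC]].
have jF : jet (fun p => derive1n p (re_part f)).
  by apply: jet_of_smooth => p x; case: (fs p x).
exists (fun p => derive1n p (re_part f)) => //.
exists (`|C| + 1); split => //.
- move=> p x; rewrite -ler_pdivrMr ?mulr_gt0 ?exprn_gt0//.
  apply: (@le_trans _ _ C); last by rewrite (le_trans (ler_norm _))// lerDl.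
  apply: le_trans (fC _ (ex_intro2 _ _ (p, x) I erefl)) => /=.
  rewrite ler_wpM2r ?invr_ge0 ?mulr_ge0 ?exprn_ge0 ?(ltW (N0 _)) ?(ltW h0)//.
  exact: (normc_Re_le (cderive f p x)).
- have oA : open [set x : R | x < -1] by exact: open_lt.
  move=> p x x1; apply: (@jet_eq0 _ _ oA jF) x1 => {}x /= x1.
  rewrite /re_part; have -> : f x = 0; last by [].
  apply/eqP/negPn/negP => fx.
  have /fsupp/= /andP[] : supp f x by apply: subset_closure.
  by rewrite leNgt x1.
Qed.

End ComplexValues.

Section Quasianalytic.
Variables (R : realType) (N : nat -> R).
Hypothesis HN : LC N.

Lemma bang_sumE (A h : R) (p n : nat) : 0 < A -> 0 < h ->
  \sum_(p <= k < n) (A * (h ^+ k * N k)) / (4 * (A * (h ^+ k.+1 * N k.+1))) =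
  (4 * h)^-1 * \sum_(p.+1 <= k < n.+1) (quotient_seq N k)^-1.
Proof.
move=> A0 h0; rewrite big_add1/= mulr_sumr; apply: eq_bigr => k _.
have /gt_eqF h1 : 0 < h ^+ k by rewrite exprn_gt0.
have /gt_eqF h2 := LC_gt0 HN k; have /gt_eqF h3 := LC_gt0 HN k.+1.
by rewrite exprS; field; rewrite h1 h2 h3 !gt_eqF.
Qed.

(** Denjoy-Carleman theorem. The function is flat at -2, to the left of its
support; as the series diverges, [bang] reaches 0 with a gain 2^p for every p. *)
Lemma quasianalytic (F : nat -> R -> R) (C h : R) : tail_sum N 1 = +oo%E ->
  0 < C -> 0 < h -> jet F -> (forall p x, `|F p x| <= C * (h ^+ p * N p)) ->
  (forall p x, x < -1 -> F p x = 0) -> F 0 0 = 0.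
Proof.
move=> Noo C0 h0 jF FC F0; apply/eqP; rewrite -normr_le0.
have Fp p : 2 ^+ p * `|F 0 0| <= C.
  have [n] := tail_sum_partial HN (8 * h + \sum_(1 <= k < p.+1) (quotient_seq N k)^-1) Noo.
  have np : (p.+1 <= n + p.+1)%N by rewrite leq_addl.
  move=> nA; have := @bang _ F _ (-2) 0 p (n + p)%N jF (log_convexZ (LC_log_convex HN) C0 h0).
  have o2 : -2 <= 0 :> R by lra.
  move=> /(_ _ _ _ o2); rewrite bang_sumE// => B; have {B} := B _ _ _ _ 0%N (leq0n p).
  rewrite !expr0 !mul1r (LC0 HN) mulr1; apply; rewrite ?leq_addl//.
    by move=> k _; rewrite F0//; lra.
  rewrite addrC subr_ge0 mulrC ler_pdivlMr ?mulr_gt0//.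
  have : \sum_(1 <= k < n) (quotient_seq N k)^-1 <= \sum_(1 <= k < n + p.+1) (quotient_seq N k)^-1.
    case: n nA {np} => [|n] nA.
      by rewrite big_geq// sumr_ge0// => k _; rewrite invr_ge0 ltW// quotient_gt0.
    rewrite [leRHS](@big_cat_nat _ _ _ n.+1)//= ?leq_addr// lerDl sumr_ge0// => k _.
    by rewrite invr_ge0 ltW// quotient_gt0.
  rewrite [leRHS](@big_cat_nat _ _ _ p.+1)//= addnS; lra.
rewrite leNgt; apply/negP => F00.
have := Fp (Num.bound (C / `|F 0 0|)).
rewrite -ler_pdivlMr// leNgt => /negP; apply.
apply: lt_trans (archi_boundP _) _; first by rewrite divr_ge0 ?ltW.
by rewrite -natrX ltr_nat ltn_expl.
Qed.

End Quasianalytic.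

(** * Necessity *)

Section Necessity.
Variables (R : realType) (N : nat -> R).
Hypothesis HN : LC N.
Hypothesis Nfin : (tail_sum N 1 < +oo)%E.

(** The function G prescribes how far from one chosen index the next one has to
be. *)
Lemma sparse_sequence (Q : nat -> nat -> Prop) (G : nat -> nat) :
  (forall n P, exists2 p, (P < p)%N & Q n p) ->
  exists s : nat -> nat, (forall n, Q n (s n)) /\ forall n, (G (s n) < s n.+1)%N.
Proof.
move=> QP; have /choice[pk pkP] (nP : nat * nat) : exists p, (nP.2 < p)%N /\ Q nP.1 p.
  by have [p ? ?] := QP nP.1 nP.2; exists p.
pose s := fix s n := if n is m.+1 then pk (m.+1, G (s m)) else pk (0%N, 0%N).
by exists s; split=> [[|n]|n]; rewrite /=; apply: (pkP (_, _)).2 || apply: (pkP (_, _)).1.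
Qed.

(** Beyond the index P, a long enough gap contains half of the tail rho_(P+1), and
leads to indices n for which 2^n absorbs the finitely many weights up to P. *)
Lemma gap_exists (M : nat -> R) (P : nat) : exists n0, forall n, (n0 <= n)%N ->
  rho N P.+1 / 2 <= \sum_(P.+1 <= k < n.+1) (quotient_seq N k)^-1 /\
  \sum_(r < P.+1) M r <= 2 ^+ n.
Proof.
have r0 : 0 < rho N P.+1 / 2 by rewrite divr_gt0// rho_gt0.
have [n1 n1P] := rho_small HN Nfin r0.
pose b := Num.bound `|\sum_(r < P.+1) M r|.
exists (P + n1 + b)%N => n nP; split.
  have E := @rho_split _ _ HN Nfin P.+1 n.+1; have {}E := E ltac:(lia).
  have := n1P n.+1 ltac:(lia); lra.
apply: le_trans (ler_norm _) _; apply/ltW/(lt_le_trans (archi_boundP _)) => //.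
rewrite -natrX ler_nat -/b; apply: (@leq_trans n); first by lia.
by rewrite ltnW// ltn_expl.
Qed.

(** The estimates of [spike_bound] at the abscissa rho_(p+1) / (8 h) read
a <= C^p (p / rho_(p+1))^(p-j) N_j, which is what L^1 asks for as long as
rho_(p+1) is comparable to rho_p. Otherwise 1 / nu_p is the main part of rho_p,
and a <= N_p <= nu_p^(p-j) N_j takes over. *)
Lemma spike_L_seq (C h a : R) (p : nat) : 0 < C -> 1 <= h -> (0 < p)%N -> a <= N p ->
  0 <= a ->
  (forall j, (j < p)%N -> a * monomial p j (rho N p.+1 / (8 * h)) <=
     6 * ((C + 2 ^+ p) * (h ^+ j * N j))) ->
  a <= (192 * (C + 1) * h) ^+ p * L_seq N 1 p.
Proof.
move=> C0 h1 p0 aN a0 aj; have h0 : 0 < h by apply: lt_le_trans h1.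
have K0 : 0 < 192 * (C + 1) * h.
  by rewrite mulr_gt0// mulr_gt0 ?ltr0n// addr_gt0.
rewrite -ler_pdivrMl ?exprn_gt0//.
apply: le_L_seq => // j jp; rewrite ler_pdivrMl ?exprn_gt0//.
set m := (p - j)%N; have m0 : (0 < m)%N by rewrite subn_gt0.
have jm : (j + m = p)%N by rewrite subnKC// ltnW.
have Nj0 := LC_gt0 HN j; have sl0 := slope_gt0 HN Nfin p0.
have rp0 := rho_gt0 HN Nfin p; have rp1 := rho_gt0 HN Nfin p.+1.
have nu0 := quotient_gt0 HN p.
have rpE := rho_recl HN Nfin p.
have [small|/ltW big] := leP ((quotient_seq N p)^-1) (rho N p.+1); last first.
  have nus : quotient_seq N p <= 2 * slope N p.
    apply: (@le_trans _ _ (2 / rho N p)).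
      rewrite ler_pdivlMr// mulrC -ler_pdivlMr// rpE; lra.
    rewrite slope_def mulrA ler_wpM2r ?invr_ge0 ?(ltW rp0)//.
    by rewrite ler_peMr// ler1n.
  apply: (le_trans aN); rewrite mulrA -{1}jm; apply: le_trans (LC_le_quotientX HN j m) _.
  rewrite ler_wpM2r ?(ltW Nj0)// jm.
  apply: (@le_trans _ _ ((2 * slope N p) ^+ m)).
    by rewrite lerXn2r ?nnegrE ?mulr_ge0 ?(ltW nu0) ?(ltW sl0).
  rewrite exprMn ler_wpM2r ?exprn_ge0 ?(ltW sl0)//.
  apply: (@le_trans _ _ (2 ^+ p)).
    by rewrite ler_weXn2l ?ler1n// leq_subr.
  by rewrite lerXn2r ?nnegrE ?(ltW K0)//; nra.
have := aj j jp; rewrite /monomial (ltnW jp) -/m.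
have [d dE] : exists d, d = rho N p.+1 / (8 * h) by eexists.
rewrite -dE; have d0 : 0 < d by rewrite dE divr_gt0// mulr_gt0.
have mf : 0 < (m`!%:R : R) by rewrite ltr0n fact_gt0.
rewrite mulrA ler_pdivrMr// -ler_pdivlMr ?exprn_gt0// => /le_trans; apply.
have mle : m`!%:R <= p%:R ^+ m :> R by rewrite -natrX ler_nat fact_le_expn// leq_subr.
have dsl : p%:R / d <= 16 * h * slope N p.
  rewrite slope_def (_ : p%:R / d = 8 * h * p%:R / rho N p.+1); last first.
    by rewrite dE; field; rewrite !gt_eqF.
  rewrite ler_pdivrMr// mulrA [leRHS]mulrAC ler_pdivlMr//.
  have : 0 <= p%:R * h by rewrite mulr_ge0// ltW.
  have : rho N p <= 2 * rho N p.+1 by lra.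
  by nra.
apply: (@le_trans _ _ (6 * ((C + 2 ^+ p) * (h ^+ j * N j)) * (16 * h * slope N p) ^+ m)).
  rewrite -mulrA ler_wpM2l ?mulr_ge0 ?addr_ge0 ?exprn_ge0 ?(ltW C0) ?(ltW h0) ?(ltW Nj0)//.
  apply: (@le_trans _ _ ((p%:R / d) ^+ m)).
    by rewrite expr_div_n ler_wpM2r// invr_ge0 exprn_ge0// ltW.
  by rewrite lerXn2r ?nnegrE ?divr_ge0 ?mulr_ge0 ?(ltW d0) ?(ltW h0) ?(ltW sl0).
rewrite [(16 * h * _) ^+ m]exprMn.
rewrite [leLHS](_ : _ = 6 * (C + 2 ^+ p) * (h ^+ j * (16 * h) ^+ m) * (slope N p ^+ m * N j)); last by ring.
rewrite ler_wpM2r ?mulr_ge0 ?exprn_ge0 ?(ltW sl0) ?(ltW Nj0)//.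
rewrite (_ : 192 * (C + 1) * h = 6 * (C + 1) * 2 * (16 * h)); last by ring.
rewrite [leRHS]exprMn ler_pM ?mulr_ge0 ?addr_ge0 ?exprn_ge0 ?mulr_ge0 ?(ltW C0) ?(ltW h0)//.
  rewrite exprMn; apply: (@le_trans _ _ (6 * (C + 1) * 2 ^+ p)).
    have : 1 <= (2 : R) ^+ p by rewrite exprn_ege1// ler1n.
    by nra.
  rewrite ler_wpM2r ?exprn_ge0// ler_eXnr//; lra.
rewrite -[in leRHS]jm exprD ler_wpM2r ?exprn_ge0 ?mulr_ge0 ?(ltW h0)//.
rewrite lerXn2r ?nnegrE ?mulr_ge0 ?(ltW h0)//; lra.
Qed.

(** If M is not dominated by L^1, pick indices s_0 < s_1 < ... with wide gaps and
M_(s_n) > (n+1)^(2 s_n) L^1_(s_n), and let a be M_(s_n) / (n+1)^(s_n) at s_n and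
0 elsewhere. The divisor puts a in the Beurling space of M, and half of the
exponent is left: a_(s_n) > (n+1)^(s_n) L^1_(s_n). A function with jet a would,
by [spike_L_seq], bound n by a constant. *)
Lemma extension_preceq (M : nat -> R) : positive_seq M -> (forall p, M p <= N p) ->
  Lambda_Beurling M `<=` @Borel_map R @` D_Roumieu N -> preceq M (L_seq N 1).
Proof.
move=> M0 MN Mext; apply: contrapT => nML.
have L0 : positive_seq (L_seq N 1) by move=> p; exact: L_seq_gt0.
have /choice[G GP] := gap_exists M.
have [] := @sparse_sequence (fun n p => n.+1%:R ^+ p ^+ 2 * L_seq N 1 p < M p)
    (fun P => maxn P (G P)).
  move=> n P; have [p Pp pM] := not_preceq M0 L0 nML (n.+1%:R ^+ 2) P.
  by exists p => //; rewrite exprAC.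
move=> s [sM sG].
have s_incr n : (s n < s n.+1)%N by apply: leq_ltn_trans (sG n); rewrite leq_maxl.
have s_mono : {mono s : m n / (m <= n)%N}.
  apply: leq_mono => m n; exact: (homo_ltn ltn_trans s_incr).
have s_ltn : {mono s : m n / (m < n)%N} by exact: leqW_mono.
have s_ge n : (n <= s n)%N by elim: n => // n /leq_ltn_trans; apply.
pose a r : R := if pselect (exists n, s n = r) is left e
  then M r / (sval (cid e)).+1%:R ^+ r else 0.
have a_s n : a (s n) = M (s n) / n.+1%:R ^+ s n.
  rewrite /a; case: pselect => [e|]; last by case; exists n.
  case: cid => m /= sm; suff -> : m = n by [].
  by apply/eqP; rewrite eqn_leq -(s_mono m n) -(s_mono n m) sm leqnn.
have a_out r : (forall n, s n <> r) -> a r = 0.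
  by rewrite /a => sr; case: pselect => // e; case: (sr _ (svalP (cid e))).
have a_ge0 r : 0 <= a r.
  by rewrite /a; case: pselect => // e; rewrite divr_ge0 ?exprn_ge0// ltW.
have a_le r : a r <= M r.
  rewrite /a; case: pselect => [e|_]; last by rewrite ltW.
  by rewrite ler_pdivrMr ?exprn_gt0// ler_peMr ?(ltW (M0 _))// exprn_ege1// ler1n.
have aL : Lambda_Beurling M (fun r => (a r)%:C)%C.
  move=> h /= h0; pose n0 := Num.bound (h^-1).
  exists (Num.max 1 h^-1 ^+ s n0) => _ [r _ <-].
  rewrite /= expr0n addr0 sqrtr_sqr ger0_norm//.
  have mx : 1 <= Num.max 1 h^-1 by rewrite le_max lexx.
  have [[n sn]|/forallNP/a_out ->] := pselect (exists n, s n = r); last first.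
    by rewrite mul0r exprn_ge0// (le_trans ler01).
  rewrite -sn a_s.
  have -> : M (s n) / n.+1%:R ^+ s n / (h ^+ s n * M (s n)) = (h^-1 / n.+1%:R) ^+ s n.
    have /gt_eqF h1 : 0 < h ^+ s n by rewrite exprn_gt0.
    have /gt_eqF h2 : 0 < (n.+1%:R : R) ^+ s n by rewrite exprn_gt0.
    have /gt_eqF h3 := M0 (s n).
    by rewrite expr_div_n exprVn; field; rewrite h1 h2 h3.
  have hi : 0 <= h^-1 by rewrite invr_ge0 ltW.
  have hn : h^-1 / n.+1%:R <= Num.max 1 h^-1.
    by rewrite ler_pdivrMr// (le_trans _ (ler_peMr _ _)) ?ler1n ?le_max ?lexx ?orbT// (le_trans ler01).
  have [nn|nn] := leqP n0 n.
    apply: (@le_trans _ _ 1); last by rewrite exprn_ege1.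
    rewrite exprn_ile1 ?divr_ge0// ler_pdivrMr// mul1r.
    by apply/ltW/(lt_le_trans (archi_boundP hi)); rewrite ler_nat leqW.
  apply: (@le_trans _ _ (Num.max 1 h^-1 ^+ s n)).
    by rewrite lerXn2r ?nnegrE ?divr_ge0// (le_trans ler01).
  by rewrite ler_weXn2l// s_mono ltnW.
have [f [h1 /= h10 fD] fB] := Mext _ aL.
have [F jF [C [C0 FC _ FB]]] := D_h_jet (LC_gt0 HN) h10 fD.
have F0 q : F q 0 = a q by rewrite FB fB.
(* h >= rho_1 keeps the abscissa rho_(p+1) / (8 h) below 1 *)
pose h := Num.max (Num.max h1 1) (rho N 1).
have hh1 : h1 <= h by rewrite !le_max lexx.
have h1h : 1 <= h by rewrite !le_max lexx !orbT.
have hrho : rho N 1 <= h by rewrite !le_max lexx !orbT.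
have h0 : 0 < h by apply: lt_le_trans h1h.
pose K := 192 * (C + 1) * h.
have K0 : 0 <= K.
  by rewrite mulr_ge0 ?(ltW h0)// mulr_ge0 ?ler0n// addr_ge0// ltW.
suff Kn n : n.+2%:R <= K.
  have := Kn (Num.bound K).
  rewrite leNgt => /negP; apply; apply: lt_trans (archi_boundP K0) _.
  by rewrite ltr_nat.
set p := s n.+1; have p0 : (0 < p)%N := leq_trans (ltn0Sn n) (s_ge n.+1).
have [gap _] := GP p (s n.+2) (leq_trans (leq_maxr _ _) (ltnW (sG n.+1))).
have [_ sumM] := GP (s n) p (leq_trans (leq_maxr _ _) (ltnW (sG n))).
(* the Taylor polynomial of order p - 1 at 0 *)
pose T q x := \sum_(r < p) a r * monomial r q x.
have jT : jet T.
  apply: (@jet_sum _ p (fun r q x => a r * monomial r q x)) => r.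
  by apply: jetZ; exact: jet_monomial.
have sum_a : \sum_(r < p) a r <= 2 ^+ p.
  apply: le_trans sumM.
  rewrite -!(big_mkord xpredT) (@big_cat_nat _ _ _ (s n).+1)//=.
  rewrite [X in _ + X]big_nat_cond [X in _ + X]big1 ?addr0.
    by apply: ler_sum => i _; exact: a_le.
  move=> r; rewrite andbT => /andP[sr rp]; apply: a_out => k sk.
  by move: sr rp; rewrite /p -sk !s_ltn ltnS leqNgt => /negP.
(* C bounds f, and 2^p bounds the polynomial T, whose last index is s_n *)
pose A := C + 2 ^+ p.
have A0 : 0 < A by rewrite addr_gt0// exprn_gt0.
pose d := rho N p.+1 / (8 * h).
have h80 : 0 < 8 * h by rewrite mulr_gt0.
have d0 : 0 <= d by rewrite divr_ge0 ?ltW// rho_gt0.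
have d1 : d <= 1.
  rewrite ler_pdivrMr// mul1r; apply: le_trans (rho_le HN Nfin (isT : (1 <= p.+1)%N)) _.
  by apply: le_trans hrho _; lra.
have hN q : 1 <= h ^+ q * N q by rewrite mulr_ege1// ?exprn_ege1// LC_ge1.
have ap : a p <= K ^+ p * L_seq N 1 p.
  apply: spike_L_seq => //; first by apply: le_trans (a_le p) (MN p).
  apply: (@spike_bound _ N F T A h (a p) d p (s n.+2)) => //.
  - exact: LC_log_convex.
  - exact: s_incr.
  - move=> q x _; apply: le_trans (FC q x) _.
    rewrite ler_pM// ?(ltW C0) ?mulr_ge0 ?exprn_ge0 ?(ltW h10) ?(ltW (LC_gt0 HN _))//.
      by rewrite lerDl exprn_ge0.
    by rewrite ler_wpM2r ?(ltW (LC_gt0 HN _))// lerXn2r ?nnegrE ?(ltW h10) ?(ltW h0).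
  - move=> q x /andP[x0 xd]; apply: le_trans (ler_norm_sum _ _ _) _.
    apply: (@le_trans _ _ (\sum_(r < p) a r)).
      apply: ler_sum => r _; rewrite ger0_norm ?mulr_ge0 ?monomial_ge0//.
      by rewrite ler_piMr// monomial_le1// x0 (le_trans xd).
    apply: (@le_trans _ _ A); last by rewrite ler_peMr// ltW.
    by apply: le_trans sum_a _; rewrite lerDr ltW.
  - move=> q qs; rewrite F0 /T; under eq_bigr do rewrite monomial0.
    have [qp|pq|->] := ltngtP q p.
    + rewrite mul0r addr0 (bigD1 (Ordinal qp))//= eqxx mulr1 big1 ?addr0// => i iq.
      by move: iq; rewrite -val_eqE/= eq_sym => /negPf ->; rewrite mulr0.
    + rewrite mul0r addr0 big1; last first.
        by move=> i _; rewrite gtn_eqF ?mulr0// (ltn_trans (ltn_ord i)).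
      apply: a_out => k sk; move: pq qs; rewrite /p -sk !s_ltn => nk.
      by rewrite ltnS leqNgt nk.
    + by rewrite mul1r big1 ?add0r// => i _; rewrite gtn_eqF ?mulr0.
  - have -> : \sum_(p <= k < s n.+2) N k / N k.+1 =
        \sum_(p.+1 <= k < (s n.+2).+1) (quotient_seq N k)^-1.
      by rewrite big_add1/=; apply: eq_bigr => k _; rewrite invf_div.
    apply: le_trans (ler_wpM2l _ gap); last by rewrite invr_ge0 mulr_ge0// ltW.
    by rewrite /d le_eqVlt; apply/orP; left; apply/eqP; field; rewrite gt_eqF.
rewrite leNgt; apply/negP => Kn.
move: ap; rewrite /p a_s -/p; apply/negP; rewrite -ltNge ltr_pdivlMr ?exprn_gt0//.
apply: le_lt_trans (sM n.+1); rewrite -/p expr2 mulrAC ler_wpM2r ?(ltW (L0 _))//.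
rewrite ler_wpM2r ?exprn_ge0// lerXn2r ?nnegrE ?(ltW Kn)//.
Qed.

End Necessity.

(** * Smooth steps by infinite convolution *)

Section SmoothSteps.
Variable R : realType.
Implicit Types (g : R -> R) (t : nat -> R).

Lemma lipschitz_continuous g (C : R) :
  (forall x y, `|g y - g x| <= C * `|y - x|) -> continuous g.
Proof.
move=> gC x; apply/cvgrPdist_le => e e0; near=> y.
have C1 : 0 < `|C| + 1 by rewrite ltr_wpDl.
apply: (@le_trans _ _ ((`|C| + 1) * `|x - y|)).
  apply: le_trans (gC y x) _; rewrite ler_wpM2r//.
  by rewrite (le_trans (ler_norm _))// lerDl.
rewrite mulrC -ler_pdivlMr//; near: y.
apply: (@cvgr_dist_le _ R^o R (nbhs x) _ id x cvg_id).
by rewrite divr_gt0.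
Unshelve. all: by end_near. Qed.

(** The integral from a - 1 works on both sides: it vanishes to the left of a, as
g does. *)
Lemma antiderivative g (a : R) : continuous g -> (forall x, x <= a -> g x = 0) ->
  exists G : R -> R, forall x : R, is_derive x 1 G (g x).
Proof.
move=> gc ga.
pose G x : R := (\int[lebesgue_measure]_(y in `[a - 1, x]) g y)%R.
exists G => x; have [ax|xa] := ltP (a - 1) x.
  have [||||dG Gg] := @continuous_FTC1_closed R g (a - 1) x (x + 1).
  - by rewrite ltrDl.
  - apply: continuous_compact_integrable; first exact: segment_compact.
    exact: continuous_subspaceT.
  - exact: ax.
  - exact: gc.
  - by rewrite -Gg derive1E; exact: derivableP.
have G0 z : z < a -> 0 = G z.
  move=> za; rewrite /G (@eq_Rintegral _ _ _ _ _ (cst 0)).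
    by rewrite Rintegral_cst// mul0r.
  move=> y; rewrite inE/= in_itv/= => /andP[_ yz].
  by rewrite ga// (le_trans yz)// ltW.
rewrite ga; last by rewrite (le_trans xa)// lerBlDr lerDl.
apply: near_eq_is_derive (is_derive_cst (0 : R) x 1).
have : nbhs x [set z | z < a].
  apply: open_nbhs_nbhs; split; first exact: open_lt.
  by rewrite /= (le_lt_trans xa)// ltrBlDr ltrDl.
by apply: filterS => z; exact: G0.
Qed.

Definition primitive g : R -> R := xget (fun=> 0) [set G | forall x : R, is_derive x 1 G (g x)].

(** The mean of g over [x - s, x + s], that is, the convolution of g with the
uniform density of half-width s. Properties of means are read off from the mean
value theorem for the primitive ([average_mvt], [average_dist]). *)
Definition average (s : R) g (x : R) : R :=
  (primitive g (x + s) - primitive g (x - s)) / (2 * s).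

Definition step (l s : R) g : Prop :=
  [/\ forall x y, `|g y - g x| <= l * `|y - x|,
      forall x, 0 <= g x <= 1,
      forall x, x <= - s -> g x = 0 &
      forall x, s <= x -> g x = 1].

Lemma primitiveP (l s : R) g : step l s g -> forall x : R, is_derive x 1 (primitive g) (g x).
Proof.
move=> [gl _ g0 _].
have := @xgetPex _ (fun=> 0) [set G | forall x : R, is_derive x 1 G (g x)].
by apply; apply: antiderivative g0; exact: lipschitz_continuous gl.
Qed.

Lemma average_mvt (l s r : R) g (x : R) : step l s g -> 0 < r ->
  exists2 c, x - r <= c <= x + r & average r g x = g c.
Proof.
move=> /primitiveP gd r0.
have xr : x - r <= x + r by lra.
have [c cx e] := mvt gd xr; exists c => //.
rewrite /average e; field; rewrite gt_eqF//.
Qed.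

Lemma average_dist (l s l' s' r C : R) g g' (x x' : R) : step l s g -> step l' s' g' -> 0 < r ->
  (forall z, `|g (x + z) - g' (x' + z)| <= C) ->
  `|average r g x - average r g' x'| <= C.
Proof.
move=> /primitiveP gd /primitiveP gd' r0 gC.
pose H z := primitive g (1 * z + x) - primitive g' (1 * z + x').
have Hd (z : R) : is_derive z 1 H (g (x + z) - g' (x' + z)).
  have d1 := @is_derive_affine _ (primitive g) (g (x + z)) 1 x z.
  have d2 := @is_derive_affine _ (primitive g') (g' (x' + z)) 1 x' z.
  rewrite mul1r ![z + _]addrC !mulr1 in d1 d2.
  exact: is_deriveB (d1 (gd _)) (d2 (gd' _)).
have rr : - r <= r by lra.
have [c _ e] := mvt Hd rr.
rewrite (_ : _ - _ = g (x + c) - g' (x' + c)) ?gC//.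
rewrite /average -mulrBl; apply: (@mulIf _ (r - - r)); first by rewrite opprK gt_eqF// addr_gt0.
rewrite -e /H !mul1r ![r + _]addrC ![- r + _]addrC; field; rewrite gt_eqF//.
Qed.

Lemma step_average (l s r : R) g : step l s g -> 0 < r -> step l (s + r) (average r g).
Proof.
move=> gs r0; have [gl g01 g0 g1] := gs; split=> [x y|x|x xs|x xs].
- apply: (average_dist gs gs r0) => z.
  by apply: le_trans (gl _ _) _; rewrite opprD addrACA subrr addr0.
- by have [c _ ->] := average_mvt x gs r0.
- by have [c /andP[c1 c2] ->] := average_mvt x gs r0; apply: g0; lra.
- by have [c /andP[c1 c2] ->] := average_mvt x gs r0; apply: g1; lra.
Qed.

Lemma average_derive (l s r : R) g (x : R) : step l s g -> 0 < r ->
  is_derive x 1 (average r g) ((g (x + r) - g (x - r)) / (2 * r)).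
Proof.
move=> /primitiveP gd r0.
have d1 := @is_derive_affine _ (primitive g) (g (x + r)) 1 r x.
have d2 := @is_derive_affine _ (primitive g) (g (x - r)) 1 (- r) x.
rewrite mul1r !mulr1 in d1 d2.
have -> : average r g = (2 * r)^-1 \*: ((fun z => primitive g (1 * z + r)) - (fun z => primitive g (1 * z - r))).
  by apply/funext => z; rewrite /average mulrC -[z in LHS]mul1r.
apply: is_derive_eq (is_deriveZ (2 * r)^-1 (is_deriveB (d1 (gd _)) (d2 (gd _)))) _.
by rewrite /GRing.scale/= mulrC.
Qed.

Definition ramp (w x : R) : R := Num.max 0 (Num.min 1 ((x + w) / (2 * w))).

Lemma ramp_step (w : R) : 0 < w -> step (2 * w)^-1 w (ramp w).
Proof.
move=> w0; have w2 : 0 < 2 * w by lra.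
have rampE x : ramp w x = Num.max 0 (Num.min 1 (x / (2 * w) + 2^-1)).
  by rewrite /ramp; congr (Num.max _ (Num.min _ _)); field; rewrite gt_eqF.
split.
- suff H x y : x <= y -> 0 <= ramp w y - ramp w x <= (2 * w)^-1 * (y - x).
    move=> x y; have [xy|/ltW xy] := leP x y; have /andP[? ?] := H _ _ xy.
      by rewrite ger0_norm// ger0_norm// subr_ge0.
    by rewrite distrC [`|y - x|]distrC ger0_norm// ger0_norm// subr_ge0.
  rewrite -(ler_pM2r (_ : 0 < (2 * w)^-1)) ?invr_gt0// => xy.
  rewrite !rampE [_ * (y - x)]mulrC mulrBl.
  move: (x / _) (y / _) xy => X Y XY.
  have clipE (z : R) : Num.max 0 (Num.min 1 z) =
      if z <= 0 then 0 else if 1 <= z then 1 else z.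
    case: (leP z 0) => z0; first by rewrite min_r ?max_l//; lra.
    case: (leP 1 z) => z1; first by rewrite max_r// ler01.
    by rewrite max_r// ltW.
  by rewrite !clipE; do !case: ifP => /idP; lra.
- by move=> x; rewrite /ramp le_max lexx/= ge_max ler01 ge_min lexx.
- move=> x xw; rewrite /ramp max_l// ge_min; apply/orP; right.
  by rewrite ler_pdivrMr// mul0r; lra.
- move=> x wx; rewrite /ramp min_l ?max_r// ler_pdivlMr//; lra.
Qed.

Section Limit.
Variables (t : nat -> R) (T w : R).
Hypothesis t_gt0 : forall k, 0 < t k.
Hypothesis t_sum : forall a b, \sum_(a <= k < b) t k <= T.
Hypothesis w_gt0 : 0 < w.

Fixpoint iter_average (n q : nat) : R -> R :=
  if n is m.+1 then average (t q) (iter_average m q.+1) else ramp w.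

Let V := iter_average.
Let l := (2 * w)^-1.

Lemma iter_average_step n q : step l (w + \sum_(q <= k < q + n) t k) (V n q).
Proof.
elim: n q => [|n IH] q; first by rewrite addn0 big_geq// addr0; exact: ramp_step.
rewrite big_ltn ?addnS ?ltnS ?leq_addr// addrCA addrC -addSn.
exact: step_average.
Qed.

Lemma iter_average_stepT n q : step l (w + T) (V n q).
Proof.
have [Vl V01 V0 V1] := iter_average_step n q; split=> // x xT; [apply: V0|apply: V1].
  by apply: le_trans xT _; rewrite lerN2 lerD2l.
by apply: le_trans xT; rewrite lerD2l.
Qed.

(** One more mean of half-width t_(q+n), applied first, moves the Lipschitz ramp
by at most l t_(q+n), and the other means do not enlarge distances. *)
Lemma iter_average_succ n q x : `|V n.+1 q x - V n q x| <= l * t (q + n)%N.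
Proof.
have l0 : 0 <= l by rewrite invr_ge0 mulr_ge0// ltW.
elim: n q x => [|n IH] q x.
  rewrite addn0 /V/=; have rs := ramp_step w_gt0.
  have [c /andP[c1 c2] ->] := average_mvt x rs (t_gt0 q).
  have [rl _ _ _] := rs; apply: le_trans (rl _ _) _.
  by rewrite ler_wpM2l// ler_norml; apply/andP; split; lra.
apply: (average_dist (iter_average_stepT n.+1 q.+1) (iter_average_stepT n q.+1) (t_gt0 q)) => z.
by rewrite addnS -addSn; exact: IH.
Qed.

(** Adding the partial sums of the l t_k makes the sequence monotone. *)
Lemma iter_average_cvg q x : cvgn (fun n => V n q x).
Proof.
have l0 : 0 <= l by rewrite invr_ge0 mulr_ge0// ltW.
pose S n := l * \sum_(q <= k < q + n) t k.
have SS n : S n.+1 = S n + l * t (q + n)%N.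
  by rewrite /S addnS big_nat_recr ?leq_addr//= mulrDr.
have SB n : S n <= l * T by rewrite ler_wpM2l.
have cS : cvgn S.
  apply: nondecreasing_is_cvgn.
    by apply/nondecreasing_seqP => n; rewrite SS lerDl mulr_ge0// ltW.
  by exists (l * T) => _ [n _ <-].
have cVS : cvgn (fun n => V n q x + S n).
  apply: nondecreasing_is_cvgn.
    apply/nondecreasing_seqP => n; rewrite SS.
    by have := iter_average_succ n q x; rewrite ler_norml => /andP[? _]; lra.
  exists (1 + l * T) => _ [n _ <-]; apply: lerD => //.
  by have [_ /(_ x)/andP[]] := iter_average_stepT n q.
rewrite (_ : (fun n => _) = (fun n => (V n q x + S n) - S n)).
  exact: is_cvgB.
by apply/funext => n; rewrite addrK.
Qed.

(** The function u_q is the ramp convolved with the uniform densities of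
half-widths t_q, t_(q+1), ...: smoothing u_(q+1) by t_q gives u_q, hence the
derivative of u_q is the central difference of u_(q+1). *)
Lemma smooth_steps : exists u : nat -> R -> R, forall q,
  [/\ forall x, 0 <= u q x <= 1,
      forall x, x <= - (w + T) -> u q x = 0,
      forall x, w + T <= x -> u q x = 1 &
      forall x : R, is_derive x 1 (u q) ((u q.+1 (x + t q) - u q.+1 (x - t q)) / (2 * t q))].
Proof.
exists (fun q x => limn (fun n => V n q x)) => q.
have Vc q' x : V n q' x @[n --> \oo] --> limn (fun n => V n q' x) by exact: iter_average_cvg.
split=> [x|x xT|x xT|x].
- apply/andP; split.
    apply: limr_ge; first exact: iter_average_cvg.
    by near=> n; have [_ /(_ x)/andP[]] := iter_average_stepT n q.
  apply: limr_le; first exact: iter_average_cvg.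
  by near=> n; have [_ /(_ x)/andP[]] := iter_average_stepT n q.
- rewrite (_ : (fun n => _) = cst 0) ?lim_cst//.
  by apply/funext => n; have [_ _ /(_ _ xT)] := iter_average_stepT n q.
- rewrite (_ : (fun n => _) = cst 1) ?lim_cst//.
  by apply/funext => n; have [_ _ _ /(_ _ xT)] := iter_average_stepT n q.
- have t2 : 0 < 2 * t q by rewrite mulr_gt0.
  apply: (@is_derive_limit _ (fun n => V n.+1 q)
    (fun n x => (V n q.+1 (x + t q) - V n q.+1 (x - t q)) / (2 * t q)) _
    (fun x => (limn (fun n => V n q.+1 (x + t q)) - limn (fun n => V n q.+1 (x - t q))) / (2 * t q)) (l / t q)) => [n z|n y z|z|z].
  + exact: average_derive (iter_average_stepT n q.+1) (t_gt0 q).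
  + have [Vl _ _ _] := iter_average_stepT n q.+1.
    rewrite -mulrBl normrM normfV [`|2 * _|]gtr0_norm// ler_pdivrMr//.
    rewrite (_ : l / t q * `|z - y| * (2 * t q) = l * `|z - y| + l * `|z - y|); last first.
      by field; rewrite gt_eqF.
    have swap (a b c d : R) : a - b - (c - d) = (a - c) - (b - d) by ring.
    rewrite swap; apply: le_trans (ler_normB _ _) _.
    by apply: lerD; apply: le_trans (Vl _ _) _; rewrite [leLHS](_ : _ = l * `|z - y|)//; congr (_ * `|_|); ring.
  + by have := Vc q z; rewrite -cvg_shiftS.
  + by apply: cvgMr_tmp; apply: cvgB; exact: Vc.
Unshelve. all: by end_near. Qed.

End Limit.

End SmoothSteps.

(** * Bump functions with prescribed widths *)

Section Bump.
Variable R : realType.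
Implicit Types (g : R -> R) (t : nat -> R).

Definition central_diff (s : R) g (x : R) : R := (g (x + s) - g (x - s)) / (2 * s).

Lemma central_diff_derive (s : R) g dg : (forall x : R, is_derive x 1 g (dg x)) ->
  forall x : R, is_derive x 1 (central_diff s g) (central_diff s dg x).
Proof.
move=> gd x.
have d1 := @is_derive_affine _ g (dg (x + s)) 1 s x.
have d2 := @is_derive_affine _ g (dg (x - s)) 1 (- s) x.
rewrite mul1r !mulr1 in d1 d2.
have -> : central_diff s g = (2 * s)^-1 \*: ((fun z => g (1 * z + s)) - (fun z => g (1 * z - s))).
  by apply/funext => z; rewrite /central_diff mulrC -[z in LHS]mul1r.
apply: is_derive_eq (is_deriveZ (2 * s)^-1 (is_deriveB (d1 (gd _)) (d2 (gd _)))) _.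
by rewrite /GRing.scale/= mulrC.
Qed.

Lemma central_diff_le (s C : R) g : 0 < s -> (forall x, `|g x| <= C) ->
  forall x, `|central_diff s g x| <= C * s^-1.
Proof.
move=> s0 gC x; have s2 : 0 < 2 * s by rewrite mulr_gt0.
rewrite normrM normfV [`|2 * s|]gtr0_norm// ler_pdivrMr//.
rewrite (_ : C / s * (2 * s) = C + C); last by field; rewrite gt_eqF.
by apply: le_trans (ler_normB _ _) _; rewrite lerD.
Qed.

(** By [smooth_steps] the q-th derivative of u_0 is the q-fold central difference
of u_q; each difference costs a factor 1 / t_k, see [iter_diff_le]. *)
Fixpoint iter_diff t (q : nat) g : R -> R :=
  if q is p.+1 then iter_diff t p (central_diff (t p) g) else g.

Lemma iter_diff_derive t q g dg : (forall x : R, is_derive x 1 g (dg x)) ->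
  forall x : R, is_derive x 1 (iter_diff t q g) (iter_diff t q dg x).
Proof. by elim: q g dg => //= q IH g dg gd; apply: IH; exact: central_diff_derive. Qed.

Lemma iter_diff_le t q g C : (forall k, 0 < t k) -> (forall x, `|g x| <= C) ->
  forall x, `|iter_diff t q g x| <= C * \prod_(k < q) (t k)^-1.
Proof.
move=> t0; elim: q g C => [|q IH] g C gC x; first by rewrite big_ord0 mulr1.
rewrite big_ord_recr/= mulrA mulrAC.
by apply: IH; exact: central_diff_le.
Qed.

Lemma jet_cst_open (F : nat -> R -> R) (A : set R) (c : R) : open A -> jet F ->
  (forall x, A x -> F 0 x = c) -> forall q x, A x -> F q.+1 x = 0.
Proof.
move=> oA jF Fc q x Ax.
have jG := jetB jF (jetZ c (@jet_monomial R 0)).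
have := jet_eq0 oA jG _ q.+1 Ax; rewrite /monomial/= mulr0 subr0; apply.
by move=> z /Fc ->; rewrite expr0 divr1 mulr1 subrr.
Qed.

(** A difference of two translates of the step u_0. *)
Lemma bump_exists t (T w : R) : (forall k, 0 < t k) ->
  (forall a b, \sum_(a <= k < b) t k <= T) -> 0 < w ->
  exists2 F, jet F & [/\
    forall q x, `|F q x| <= 2 * \prod_(k < q) (t k)^-1,
    forall q x, 3 * (w + T) < `|x| -> F q x = 0 &
    forall q, F q 0 = (q == 0%N)%:R].
Proof.
move=> t0 tT w0.
have T0 : 0 <= T by apply: le_trans (tT 0 0); rewrite big_geq.
have [u uP] := smooth_steps t0 tT w0.
pose S := w + T; have S0 : 0 < S by rewrite /S; lra.
pose U q := iter_diff t q (u q).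
have jU : jet U.
  move=> q x; have [_ _ _ ud] := uP q.
  exact: (iter_diff_derive t q ud).
have UB q x : `|U q x| <= 1 * \prod_(k < q) (t k)^-1.
  apply: iter_diff_le => // z; have [/(_ z)/andP[? ?] _ _ _] := uP q.
  by rewrite ger0_norm.
have [_ ul ur _] := uP 0%N; rewrite -/S in ul ur.
have := jetB (jet_affine 1 (2 * S) jU) (jet_affine 1 (- (2 * S)) jU).
(* both translates are constant for |x| < S, where the difference is 1, and on
   either side of |x| > 3 S, where it is 0 *)
pose F q x := U q (x + 2 * S) - U q (x - 2 * S).
have -> : (fun q x => 1 ^+ q * U q (1 * x + 2 * S) - 1 ^+ q * U q (1 * x + - (2 * S))) = F.
  by apply/funext => q; apply/funext => x; rewrite expr1n !mul1r.
move=> jF; exists F => //; split.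
- move=> q x; rewrite /F (_ : 2 * _ = 1 * \prod_(k < q) (t k)^-1 + 1 * \prod_(k < q) (t k)^-1); last by ring.
  by apply: le_trans (ler_normB _ _) _; rewrite lerD.
- move=> q x; rewrite -/S lter_normr => /orP[] xS.
    have oA : open [set z : R | 3 * S < z] by exact: open_gt.
    apply: (jet_eq0 oA jF) => //.
    by move=> z /= zS; rewrite /F /U/= !ur ?subrr//; lra.
  have oA : open [set z : R | z < - (3 * S)] by exact: open_lt.
  apply: (jet_eq0 oA jF).
    by move=> z /= zS; rewrite /F /U/= !ul ?subrr//; lra.
  by rewrite /=; lra.
- case=> [|q].
    by rewrite /F /U/= ur ?ul ?subr0//; lra.
  have oA : open ([set z : R | - S < z] `&` [set z | z < S]).
    by apply: openI; [exact: open_gt|exact: open_lt].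
  apply: (jet_cst_open (c := 1) oA jF); last by split => /=; lra.
  by move=> z [/= z1 z2]; rewrite /F /U/= ur ?ul ?subr0//; lra.
Qed.

End Bump.

(** * Widths adapted to the weight *)

Section Blocks.
Variables (R : realType) (N : nat -> R).
Hypothesis HN : LC N.
Hypothesis Nfin : (tail_sum N 1 < +oo)%E.

Lemma leq_bin_expn (n m : nat) : ('C(n, m) <= 2 ^ n)%N.
Proof.
elim: n m => [|n IH] [|m]; rewrite ?bin0 ?bin0n ?expn_gt0//.
by rewrite binS expnS mul2n -addnn leq_add.
Qed.

(** A cheap substitute for p^n / n! <= e^p: the falling factorial of p + n is
n! times a binomial coefficient, hence at most n! 2^(p+n). *)
Lemma leq_expn_fact (p n : nat) : (n <= p)%N -> (p ^ n <= 4 ^ p * n`!)%N.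
Proof.
move=> np; apply: (@leq_trans ((p + n) ^_ n)).
  elim: n {np} => // n IH; rewrite addnS ffactSS expnS leq_mul//.
  by rewrite leqW// leq_addr.
rewrite -bin_ffact leq_mul2r; apply/orP; right.
apply: leq_trans (leq_bin_expn _ _) _.
by rewrite (_ : 4 = 2 ^ 2)%N// -expnM leq_exp2l// mul2n -addnn leq_add2l.
Qed.

Lemma succ_mul_expn_le (S nu : R) (d : nat) : 0 <= S -> 0 < nu ->
  d.+1%:R * S ^+ d <= (S + nu^-1) ^+ d.+1 * nu.
Proof.
move=> S0 nu0.
have -> : (S + nu^-1) ^+ d.+1 * nu = (S + nu^-1) ^+ d * (S * nu + 1).
  by rewrite exprSr; field; rewrite gt_eqF.
have nui : 0 < nu^-1 by rewrite invr_gt0.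
elim: d => [|d IH]; first by rewrite !expr0; nra.
rewrite exprS [in leRHS]exprS.
have P0 : 0 <= S ^+ d by rewrite exprn_ge0.
have Q0 : S ^+ d <= (S + nu^-1) ^+ d by rewrite lerXn2r ?nnegrE ?addr_ge0 ?(ltW nui)// lerDl ltW.
move: (S ^+ d) ((S + nu^-1) ^+ d) P0 Q0 IH => P Q P0 PQ IH.
have nn : nu^-1 * nu = 1 by rewrite mulVf ?gt_eqF.
rewrite -natr1 mulrDl mul1r.
rewrite (_ : (S + nu^-1) * Q * (S * nu + 1) = S * (Q * (S * nu + 1)) + Q * (S * (nu^-1 * nu) + nu^-1)); last by ring.
rewrite nn mulr1; apply: lerD; first by rewrite mulrCA ler_wpM2l.
rewrite mulrC; apply: (@le_trans _ _ (Q * S)); first by rewrite ler_wpM2r.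
by rewrite ler_wpM2l ?(le_trans P0)// lerDl ltW.
Qed.

(** The d-th power of a sum of d positive terms is at least d! times their
product, here N_a / N_(a+d). *)
Lemma sum_quotient_ge (a d : nat) :
  d`!%:R * N a <= (\sum_(a.+1 <= k < (a + d).+1) (quotient_seq N k)^-1) ^+ d * N (a + d)%N.
Proof.
elim: d => [|d IH]; first by rewrite addn0 expr0 fact0.
rewrite addnS big_nat_recr ?ltnS ?leq_addr//=.
set S := \sum_(_ <= _ < _) _ in IH *.
have S0 : 0 <= S by apply: sumr_ge0 => k _; rewrite invr_ge0 ltW// quotient_gt0.
rewrite -[X in _ + X^-1]/(quotient_seq N (a + d).+1) (LC_succ HN).
have nu0 := quotient_gt0 HN (a + d).+1; set nu := quotient_seq N _ in nu0 *.
have Sx := succ_mul_expn_le d S0 nu0.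
rewrite mulrA factS natrM -mulrA; apply: (@le_trans _ _ (d.+1%:R * (S ^+ d * N (a + d)%N))).
  by rewrite ler_wpM2l.
by rewrite mulrA ler_wpM2r// ltW// LC_gt0.
Qed.

(** Raising the order of differentiation by d from a on allows the factor
N_(a+d) / N_a, which is worth at least d powers of the slope up to 4^p. *)
Lemma slope_weight (p a d : nat) : (0 < p)%N -> (p <= a)%N -> (d <= p)%N ->
  slope N p ^+ d * N a <= 4 ^+ p * N (a + d)%N.
Proof.
move=> p0 pa dp; have rp0 := rho_gt0 HN Nfin p.
have df : 0 < (d`!%:R : R) by rewrite ltr0n fact_gt0.
have Nad := LC_gt0 HN (a + d).
have S_le : \sum_(a.+1 <= k < (a + d).+1) (quotient_seq N k)^-1 <= rho N p.
  apply: le_trans (rho_le HN Nfin (leqW pa)).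
  rewrite (@rho_split _ _ HN Nfin a.+1 (a + d).+1) ?ltnS ?leq_addr// lerDl.
  by rewrite ltW// rho_gt0.
have key : d`!%:R * N a <= rho N p ^+ d * N (a + d)%N.
  apply: le_trans (sum_quotient_ge a d) _; rewrite ler_wpM2r ?(ltW Nad)//.
  rewrite lerXn2r ?nnegrE ?(ltW rp0)// sumr_ge0// => k _.
  by rewrite invr_ge0 ltW// quotient_gt0.
rewrite slope_def expr_div_n mulrAC ler_pdivrMr ?exprn_gt0//.
apply: (@le_trans _ _ (4 ^+ p * (d`!%:R * N a))).
  rewrite mulrA ler_wpM2r ?(ltW (LC_gt0 HN _))//.
  by rewrite -!natrX -natrM ler_nat leq_expn_fact.
by rewrite -mulrA ler_wpM2l ?exprn_ge0// mulrC [_ * rho _ _ ^+ _]mulrC mulrC.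
Qed.

Section Widths.
Variable p : nat.
Hypothesis p_gt0 : (0 < p)%N.

(** The first p widths, all equal, share rho_p; they are used for derivatives of
order at most p. Beyond, 1 / nu_k is enlarged by the factor
sqrt (rho_p / rho_k). This factor tends to infinity, which brings the bump into
the Beurling class, and yet the widths remain summable, with a sum comparable to
rho_p: (1 / nu_k) / sqrt rho_k is at most
2 (sqrt rho_k - sqrt rho_(k+1)). *)
Definition width (k : nat) : R := if (k < p)%N then rho N p / p%:R
  else Num.sqrt (rho N p) * ((quotient_seq N k)^-1 / Num.sqrt (rho N k)).

Let sqrt_rho_gt0 k : 0 < Num.sqrt (rho N k).
Proof. by rewrite sqrtr_gt0 rho_gt0. Qed.

Lemma width_gt0 k : 0 < width k.
Proof.
rewrite /width; case: ifP => _; first by rewrite divr_gt0 ?rho_gt0 ?ltr0n.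
by rewrite mulr_gt0// divr_gt0// invr_gt0 quotient_gt0.
Qed.

Lemma width_sum a b : \sum_(a <= k < b) width k <= 3 * rho N p.
Proof.
have rp0 := rho_gt0 HN Nfin p.
apply: (@le_trans _ _ (\sum_(0 <= k < b) width k)).
  have [ab|ba] := leqP a b; last first.
    by rewrite big_geq 1?ltnW// sumr_ge0// => k _; rewrite ltW// width_gt0.
  by rewrite [leRHS](@big_cat_nat _ _ _ a)//= lerDr sumr_ge0// => k _; rewrite ltW// width_gt0.
(* a potential whose increments dominate the widths *)
pose Phi k := if (k <= p)%N then rho N p / p%:R * k%:R
  else rho N p + 2 * Num.sqrt (rho N p) * (Num.sqrt (rho N p) - Num.sqrt (rho N k)).
have pn0 : (p%:R : R) != 0 by rewrite pnatr_eq0 -lt0n.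
have sq k : Num.sqrt (rho N k) * Num.sqrt (rho N k) = rho N k.
  by rewrite -expr2 sqr_sqrtr// ltW// rho_gt0.
have PhiE k : (p <= k)%N -> Phi k =
    rho N p + 2 * Num.sqrt (rho N p) * (Num.sqrt (rho N p) - Num.sqrt (rho N k)).
  rewrite leq_eqVlt /Phi => /predU1P[<-|pk]; last by rewrite leqNgt pk.
  by rewrite leqnn subrr mulr0 addr0 divfK.
apply: (@le_trans _ _ (Phi b)).
  elim: b => [|b IH]; first by rewrite big_geq// /Phi mulr0.
  rewrite big_nat_recr//=; apply: (le_trans (lerD IH (lexx _))).
  rewrite /width; have [bp|pb] := ltnP b p.
    by rewrite /Phi (ltnW bp) bp -natr1 mulrDr mulr1.
  rewrite !PhiE// 1?leqW// -addrA lerD2l -lerBrDl.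
  have s0 := sqrt_rho_gt0 p; have s1 := sqrt_rho_gt0 b; have s2 := sqrt_rho_gt0 b.+1.
  have q1 := sq b; have q2 := sq b.+1; have rb := rho_recl HN Nfin b.
  rewrite [leRHS](_ : _ = Num.sqrt (rho N p) * (2 * (Num.sqrt (rho N b) - Num.sqrt (rho N b.+1)))); last by ring.
  rewrite ler_wpM2l ?(ltW s0)// ler_pdivrMr//.
  have : Num.sqrt (rho N b.+1) <= Num.sqrt (rho N b).
    by rewrite ler_wsqrtr// rho_le.
  by nra.
have := sq p; have := sqrt_rho_gt0 p; have := sqrt_rho_gt0 b; rewrite /Phi.
case: leqP => [bp|_]; last by nra.
move=> _ _ _; apply: (@le_trans _ _ (rho N p)); last by lra.
rewrite -mulrA ler_piMr ?(ltW rp0)// mulrC ler_pdivrMr ?ltr0n// mul1r.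
by rewrite ler_nat.
Qed.

Lemma inv_width_large k : (p <= k)%N ->
  (width k)^-1 <= Num.sqrt (rho N k) / Num.sqrt (rho N p) * quotient_seq N k.+1.
Proof.
move=> pk; rewrite /width ltnNge pk/= invfM invf_div invrK mulrA [_^-1 * _]mulrC.
rewrite ler_wpM2l ?divr_ge0 ?sqrtr_ge0//.
by apply: (@quotient_le _ _ HN k k.+1); rewrite (leq_trans p_gt0 pk) leqnSn.
Qed.

Lemma inv_width_prod q : \prod_(k < q) (width k)^-1 <=
  slope N p ^+ minn q p * (N (maxn q p) / N p).
Proof.
elim: q => [|q IH].
  by rewrite big_ord0 min0n max0n expr0 mul1r divff// gt_eqF// LC_gt0.
have w0 : 0 <= (width q)^-1 by rewrite invr_ge0 ltW// width_gt0.
have Np := LC_gt0 HN p.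
rewrite big_ord_recr/=; apply: le_trans (ler_wpM2r w0 IH) _.
have [qp|pq] := ltnP q p.
  rewrite (minn_idPl qp) (maxn_idPr qp).
  by rewrite /width qp invf_div slope_def exprSr mulrAC.
rewrite (minn_idPr (leqW pq)) (maxn_idPl (leqW pq)).
rewrite -mulrA ler_wpM2l ?exprn_ge0 ?slope_ge0// LC_succ// mulrAC ler_wpM2r ?invr_ge0 ?(ltW Np)//.
rewrite mulrC ler_wpM2r ?(ltW (LC_gt0 HN _))//.
apply: le_trans (inv_width_large pq) _.
rewrite ler_piMl ?(ltW (quotient_gt0 HN _))// ler_pdivrMr// mul1r.
by rewrite ler_wsqrtr// rho_le.
Qed.

(** From some index on, each further derivative gains the factor h on top of
nu_(q+1), since sqrt (rho_k / rho_p) tends to 0. *)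
Lemma inv_width_prod_small (h : R) : 0 < h -> exists2 C, 0 <= C &
  forall q, \prod_(k < q) (width k)^-1 <= C * (h ^+ q * N q).
Proof.
move=> h0; have rp0 := rho_gt0 HN Nfin p.
have [K0 K0P] := rho_small HN Nfin (mulr_gt0 rp0 (exprn_gt0 2 h0)).
pose K := maxn p K0.
have hN q : 0 < h ^+ q * N q by rewrite mulr_gt0 ?exprn_gt0 ?(LC_gt0 HN).
pose b q := \prod_(k < q) (width k)^-1 / (h ^+ q * N q).
have P0 q : 0 <= \prod_(k < q) (width k)^-1.
  by apply: prodr_ge0 => k _; rewrite invr_ge0 ltW// width_gt0.
have b0 q : 0 <= b q.
  by apply: divr_ge0; rewrite ?P0// ltW.
have bS q : (K <= q)%N -> b q.+1 <= b q.
  move=> Kq; rewrite /b big_ord_recr/= ler_pdivrMr// mulrAC -mulrA ler_wpM2l ?P0//.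
  rewrite [leRHS](_ : _ = h * quotient_seq N q.+1); last first.
    rewrite exprS (LC_succ HN); field.
    by rewrite !gt_eqF ?exprn_gt0 ?(LC_gt0 HN).
  apply: le_trans (inv_width_large (leq_trans (leq_maxl _ _) Kq)) _.
  rewrite ler_wpM2r ?(ltW (quotient_gt0 HN _))// ler_pdivrMr//.
  rewrite -[h]ger0_norm ?(ltW h0)// -sqrtr_sqr -sqrtrM ?sqr_ge0//.
  by rewrite ler_wsqrtr// mulrC K0P// (leq_trans (leq_maxr _ _) Kq).
exists (\sum_(k < K.+1) b k) => [|q]; first by rewrite sumr_ge0.
rewrite -ler_pdivrMr// -/(b q).
have small r : (r <= K)%N -> b r <= \sum_(k < K.+1) b k.
  by move=> rK; rewrite (bigD1 (Ordinal (rK : (r < K.+1)%N)))//= lerDl sumr_ge0.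
have [/small//|/ltnW Kq] := leqP q K.
apply: le_trans (small K (leqnn K)).
rewrite -(subnKC Kq); elim: (q - K)%N => [|d IH]; first by rewrite addn0.
by rewrite addnS; apply: le_trans IH; rewrite bS// leq_addr.
Qed.

Lemma width_bump : exists2 F, jet F & [/\
    forall q x, `|F q x| <= 2 * \prod_(k < q) (width k)^-1,
    forall q x, 12 * rho N p < `|x| -> F q x = 0 &
    forall q, F q 0 = (q == 0%N)%:R].
Proof.
have [F jF [FB FS F0]] := bump_exists width_gt0 width_sum (rho_gt0 HN Nfin p).
exists F => //; split=> // q x xr; apply: FS; apply: le_lt_trans xr; lra.
Qed.

End Widths.
End Blocks.

(** * Blocks realizing one derivative *)

Section BlockJets.
Variables (R : realType) (N : nat -> R).
Hypothesis HN : LC N.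
Hypothesis Nfin : (tail_sum N 1 < +oo)%E.

Lemma monomial_slope (p i : nat) (x : R) : (0 < p)%N -> (i <= p)%N -> `|x| <= 12 * rho N p ->
  `|monomial p i x| * slope N p ^+ (p - i) <= 48 ^+ p.
Proof.
move=> p0 ip xr; rewrite /monomial ip; set n := (p - i)%N.
have rp0 := rho_gt0 HN Nfin p.
have nf : 0 < (n`!%:R : R) by rewrite ltr0n fact_gt0.
rewrite normrM normrX normfV (gtr0_norm nf) mulrAC ler_pdivrMr//.
apply: (@le_trans _ _ ((12 * rho N p) ^+ n * slope N p ^+ n)).
  rewrite ler_wpM2r ?exprn_ge0 ?slope_ge0// lerXn2r ?nnegrE//.
  by rewrite mulr_ge0 ?ltW.
rewrite -exprMn slope_def (_ : 12 * rho N p * (p%:R / rho N p) = 12 * p%:R); last first.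
  by field; rewrite gt_eqF.
rewrite (_ : 48 = 12 * 4 :> R); last by ring.
rewrite !exprMn -mulrA ler_pM ?exprn_ge0//.
  by rewrite ler_weXn2l ?leq_subr// ler1n.
by rewrite -!natrX -natrM ler_nat leq_expn_fact// leq_subr.
Qed.

(** The i-th derivative falls on x^p / p! and the m-th one on the bump. If
m + i < p, this is the term of index m + i in the definition of L^1. Otherwise
L^1_p <= 2^p N_p, and the surplus of slopes is exchanged for weights by
[slope_weight]. *)
Lemma slope_trade (p i m : nat) : (0 < p)%N -> (i <= p)%N ->
  slope N p ^+ minn m p * N (maxn m p) * L_seq N 1 p <=
  8 ^+ p * N (m + i)%N * N p * slope N p ^+ (p - i).
Proof.
move=> p0 ip; set s := slope N p.
have s0 : 0 <= s by exact: slope_ge0.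
have L0 := L_seq_gt0 HN Nfin p; have LN := L_seq_le_weight HN Nfin p.
have Np := LC_gt0 HN p; have Nq := LC_gt0 HN (m + i).
have e8 : (8 : R) ^+ p = 2 ^+ p * 4 ^+ p by rewrite -exprMn -natrM.
have [mp|pm] := leqP m p; last first.
  have key := @slope_weight _ _ HN Nfin p m i p0 (ltnW pm) ip.
  rewrite -[in X in s ^+ X * _ * _](subnK ip) exprD.
  apply: (@le_trans _ _ (s ^+ (p - i) * (4 ^+ p * N (m + i)%N) * (2 ^+ p * N p))).
    rewrite -[s ^+ _ * _ * N m]mulrA; apply: ler_pM => //.
    - by rewrite !mulr_ge0 ?exprn_ge0 ?(ltW (LC_gt0 HN _)).
    - exact: ltW.
    - by rewrite ler_wpM2l ?exprn_ge0.
  by rewrite e8 le_eqVlt; apply/orP; left; apply/eqP; ring.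
have [qp|pq] := ltnP (m + i)%N p.
  have key := L_seq_le HN Nfin qp; rewrite -/s in key.
  apply: (@le_trans _ _ (s ^+ m * N p * (s ^+ (p - (m + i)) * N (m + i)%N))).
    by rewrite ler_wpM2l// mulr_ge0 ?exprn_ge0// ltW.
  rewrite (_ : p - i = m + (p - (m + i)))%N; last by lia.
  rewrite exprD; set a := s ^+ m; set b := s ^+ _.
  have : 0 <= N (m + i)%N * N p * (a * b) by rewrite !mulr_ge0 ?exprn_ge0 ?(ltW Nq) ?(ltW Np).
  have : 1 <= (8 : R) ^+ p by rewrite exprn_ege1// ler1n.
  move: (8 ^+ p) => e; nra.
have dp : (m + i - p <= p)%N by lia.
have key := slope_weight HN Nfin p0 (leqnn p) dp.
rewrite subnKC// -/s in key.
rewrite [in s ^+ m](_ : m = (p - i) + (m + i - p))%N; last by lia.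
rewrite exprD.
apply: (@le_trans _ _ (s ^+ (p - i) * (4 ^+ p * N (m + i)%N) * (2 ^+ p * N p))).
  rewrite -[s ^+ _ * _ * N p]mulrA; apply: ler_pM => //.
  - by rewrite !mulr_ge0 ?exprn_ge0 ?(ltW Np).
  - exact: ltW.
  - by rewrite ler_wpM2l ?exprn_ge0.
by rewrite e8 le_eqVlt; apply/orP; left; apply/eqP; ring.
Qed.

Lemma sum_bin (q : nat) : \sum_(i < q.+1) 'C(q, i)%:R = 2 ^+ q :> R.
Proof.
rewrite (_ : 2 = 1 + 1 :> R) ?exprDn; last by ring.
by apply: eq_bigr => i _; rewrite !expr1n mulr1.
Qed.

Lemma leibniz_le (F G : nat -> R -> R) (C : R) (q : nat) (x : R) :
  (forall i, (i <= q)%N -> `|F i x| * `|G (q - i)%N x| <= C) ->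
  `|\sum_(i < q.+1) 'C(q, i)%:R * (F i x * G (q - i)%N x)| <= 2 ^+ q * C.
Proof.
move=> FG; apply: le_trans (ler_norm_sum _ _ _) _.
rewrite -sum_bin mulr_suml; apply: ler_sum => i _.
by rewrite !normrM normr_nat ler_wpM2l// FG// -ltnS.
Qed.

Definition beurling_class (F : nat -> R -> R) : Prop := forall h : R, 0 < h ->
  exists2 C, 0 <= C & forall q x, `|F q x| <= C * (h ^+ q * N q).

Lemma bump_beurling_class (p : nat) (F : nat -> R -> R) : (0 < p)%N ->
  (forall q x, `|F q x| <= 2 * \prod_(k < q) (width N p k)^-1) -> beurling_class F.
Proof.
move=> p0 FB h h0; have [C C0 CP] := inv_width_prod_small HN Nfin p0 h0.
exists (2 * C) => [|q x]; first by rewrite mulr_ge0.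
by apply: le_trans (FB q x) _; rewrite -mulrA ler_wpM2l.
Qed.

(** The block of order p is x^p / p! times the bump of [width_bump]. *)
Lemma block_pos (p : nat) : (0 < p)%N -> exists2 F, jet F & [/\
  forall q x, `|F q x| * L_seq N 1 p <= 2 * 384 ^+ p * (2 ^+ q * N q),
  forall q x, 12 * rho N p < `|x| -> F q x = 0,
  forall q, F q 0 = (q == p)%:R & beurling_class F].
Proof.
move=> p0; have [F jF [FB FS F0]] := width_bump HN Nfin p0.
have jM := jetM (@jet_monomial R p) jF.
exists (fun q x => \sum_(i < q.+1) 'C(q, i)%:R * (monomial p i x * F (q - i)%N x)) => //.
have L0 := L_seq_gt0 HN Nfin p; have Np := LC_gt0 HN p.
have out q x : 12 * rho N p < `|x| ->
    \sum_(i < q.+1) 'C(q, i)%:R * (monomial p i x * F (q - i)%N x) = 0.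
  by move=> xr; rewrite big1// => i _; rewrite FS// !mulr0.
have monout i x : (p < i)%N -> monomial p i x = 0 :> R by rewrite /monomial ltnNge => /negPf ->.
have [K KE] : exists K : R, K = 384 ^+ p by eexists.
have K0 : 0 <= K by rewrite KE; apply: exprn_ge0; exact: ler0n.
rewrite -KE; split=> [q x|//|q|h h0].
- have Nq := LC_gt0 HN q.
  have [xr|/out ->] := leP `|x| (12 * rho N p); last first.
    by rewrite normr0 mul0r !mulr_ge0 ?exprn_ge0// ltW.
  rewrite -ler_pdivlMr//; apply: le_trans (leibniz_le (C := 2 * K * N q / L_seq N 1 p) _) _; last first.
    by rewrite le_eqVlt; apply/orP; left; apply/eqP; ring.
  move=> i iq; have [ip|/monout ->] := leqP i p; last first.
    by rewrite normr0 mul0r divr_ge0 ?(ltW L0)// !mulr_ge0 ?exprn_ge0// ltW.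
  have s0 : 0 < slope N p ^+ (p - i) by rewrite exprn_gt0// slope_gt0.
  have M := monomial_slope p0 ip xr.
  have tr := @slope_trade p i (q - i) p0 ip; rewrite subnK// in tr.
  have B : `|F (q - i)%N x| * N p <= 2 * (slope N p ^+ minn (q - i) p * N (maxn (q - i) p)).
    rewrite -ler_pdivlMr// -!mulrA; apply: le_trans (FB _ x) _.
    by rewrite ler_wpM2l// inv_width_prod.
  rewrite ler_pdivlMr// -(ler_pM2r s0) -(ler_pM2r Np).
  move: M tr B; move: (monomial _ _ _) (F _ _) (slope _ _ ^+ (p - i)) (slope _ _ ^+ minn _ _) s0 => m f s s' s0 M tr B.
  have -> : K = 48 ^+ p * 8 ^+ p by rewrite KE -exprMn -natrM.
  apply: (@le_trans _ _ ((`|m| * s) * (`|f| * N p * L_seq N 1 p))).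
    by rewrite le_eqVlt; apply/orP; left; apply/eqP; ring.
  apply: (@le_trans _ _ (48 ^+ p * (2 * (8 ^+ p * N q * N p * s)))); last first.
    by rewrite le_eqVlt; apply/orP; left; apply/eqP; ring.
  apply: ler_pM => //; rewrite ?mulr_ge0 ?(ltW s0) ?(ltW L0) ?(ltW Np)//.
  apply: le_trans (_ : 2 * (s' * N (maxn (q - i) p)) * L_seq N 1 p <= _).
    by rewrite ler_wpM2r// ltW.
  by rewrite -mulrA ler_wpM2l.
- have [qp|pq|->] := ltngtP q p.
  + rewrite big1// => i _; rewrite monomial0 ltn_eqF ?mul0r ?mulr0//.
    by apply: leq_ltn_trans qp; rewrite -ltnS.
  + rewrite big1// => i _; rewrite monomial0 F0.
    have [->|] := eqVneq (nat_of_ord i) p; last by rewrite mul0r mulr0.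
    by rewrite subn_eq0 leqNgt pq !mulr0.
  + rewrite big_ord_recr/= big1 => [|i _].
      by rewrite monomial0 F0 subnn !eqxx binn !mul1r add0r.
    by rewrite monomial0 ltn_eqF// mul0r mulr0.
- have h20 : 0 < h / 2 by rewrite divr_gt0.
  have [C C0 CP] := bump_beurling_class p0 FB h20.
  (* the 2^q of the Leibniz rule is compensated by using the bounds of the bump
     for h / 2 *)
  pose A := Num.max 1 (12 * rho N p); pose B := Num.max 1 (h / 2)^-1.
  have A1 : 1 <= A by rewrite le_max lexx.
  have B1 : 1 <= B by rewrite le_max lexx.
  have A0 : 0 <= A by apply: le_trans A1.
  have B0 : 0 <= B by apply: le_trans B1.
  exists (A ^+ p * (C * B ^+ p)) => [|q x]; first by rewrite !mulr_ge0 ?exprn_ge0.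
  have Nq := LC_gt0 HN q.
  have [xr|/out ->] := leP `|x| (12 * rho N p); last first.
    by rewrite normr0 !mulr_ge0 ?exprn_ge0 ?(ltW h0)// ltW.
  apply: le_trans (leibniz_le (C := A ^+ p * (C * B ^+ p) * ((h / 2) ^+ q * N q)) _) _; last first.
    rewrite -[in leRHS](divfK (_ : 2 != 0) h)// [in leRHS]exprMn.
    by rewrite le_eqVlt; apply/orP; left; apply/eqP; ring.
  move=> i iq; have [ip|/monout ->] := leqP i p; last first.
    by rewrite normr0 mul0r !mulr_ge0 ?exprn_ge0// ?ltW.
  have M : `|monomial p i x| <= A ^+ p.
    rewrite /monomial ip normrM normrX normfV normr_nat.
    apply: (@le_trans _ _ (A ^+ (p - i))); last by rewrite ler_weXn2l// leq_subr.
    apply: (@le_trans _ _ (`|x| ^+ (p - i))).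
      by rewrite ler_piMr ?exprn_ge0// invf_le1 ?ltr0n ?fact_gt0// ler1n fact_gt0.
    by rewrite lerXn2r ?nnegrE// (le_trans xr)// le_max lexx orbT.
  rewrite -!mulrA; apply: ler_pM => //; apply: le_trans (CP _ x) _.
  rewrite ler_wpM2l// mulrA; apply: ler_pM => //.
  - by rewrite exprn_ge0// ltW.
  - exact/ltW/LC_gt0.
  - rewrite -[in leRHS](subnK iq) exprD mulrCA ler_peMr ?exprn_ge0 ?(ltW h20)//.
    apply: (@le_trans _ _ (B ^+ i * (h / 2) ^+ i)); last first.
      by rewrite ler_wpM2r ?exprn_ge0 ?(ltW h20)// ler_weXn2l.
    rewrite -exprMn exprn_ege1// -ler_pdivrMr// mul1r.
    by rewrite le_max lexx orbT.
  - by apply: (LC_le HN); rewrite leq_subr.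
Qed.

(** The bump itself, with the widths of order 1, serves as the block of order
0. *)
Lemma blocks : exists A K : R, [/\ 0 < A, 0 < K & forall p, exists2 F, jet F & [/\
  forall q x, `|F q x| * L_seq N 1 p <= A * K ^+ p * (2 ^+ q * N q),
  forall q x, 12 * rho N p < `|x| -> F q x = 0,
  forall q, F q 0 = (q == p)%:R & beurling_class F]].
Proof.
have s0 := slope_ge0 HN Nfin 1.
exists (2 * (1 + slope N 1)), 384; split=> [||[|p]]; first by rewrite mulr_gt0// ltr_pwDl.
- by rewrite ltr0n.
- have [F jF [FB FS F0]] := width_bump HN Nfin (ltn0Sn 0).
  exists F => //; split=> //; last exact: bump_beurling_class FB.
    move=> q x; rewrite mulr1 expr0 mulr1 -mulrA.
    have Nq := LC_ge1 HN q; have N1 := LC_ge1 HN 1.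
    apply: le_trans (FB q x) _; rewrite ler_wpM2l//.
    apply: le_trans (inv_width_prod HN Nfin (ltn0Sn 0) q) _.
    have q2 : 1 <= (2 : R) ^+ q by rewrite exprn_ege1// ler1n.
    case: q Nq q2 => [|q] Nq q2.
      by rewrite min0n max0n expr0 divff ?mul1r; nra.
    rewrite (minn_idPr _)// (maxn_idPl _)// expr1.
    have Nq0 : 0 <= N q.+1 by apply: le_trans Nq.
    have N10 : 0 < N 1 by apply: lt_le_trans N1.
    apply: ler_pM => //; first by rewrite divr_ge0// ltW.
      by rewrite lerDr.
    apply: (@le_trans _ _ (N q.+1)); last by rewrite ler_peMl.
    by rewrite ler_pdivrMr// ler_peMr.
  move=> q x xr; apply: FS; apply: le_lt_trans xr.
  by rewrite ler_wpM2l// rho_le.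
- have [F jF [FB FS F0 FC]] := block_pos (ltn0Sn p).
  exists F => //; split=> // q x; apply: le_trans (FB q x) _.
  rewrite ler_wpM2r ?mulr_ge0 ?exprn_ge0 ?(ltW (LC_gt0 HN _))//.
  apply: ler_wpM2r; last by lra.
  by apply: exprn_ge0; exact: ler0n.
Qed.

End BlockJets.

(** * Summation of the blocks *)

Section Series.
Variables (R : realType).
Implicit Types (G : nat -> nat -> R -> R).

Lemma half_sum_le (n : nat) : \sum_(p < n) (2^-1 : R) ^+ p <= 2.
Proof.
apply: le_trans (geometric_le2 R n); rewrite lerDl exprn_ge0//.
Qed.

(** The geometric majorant gives pointwise convergence of the sums of all orders,
and its value for order q + 2 is the Lipschitz constant required by
[is_derive_limit] at order q. *)
Lemma jet_series G (B : nat -> R) : (forall p, jet (G p)) ->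
  (forall p q x, `|G p q x| <= B q * 2^-1 ^+ p) ->
  exists2 S, jet S & (forall C q x, (forall p, `|G p q x| <= C * 2^-1 ^+ p) ->
     `|S q x| <= C * 2) /\
   (forall q r x, (forall p, p != r -> G p q x = 0) -> S q x = G r q x).
Proof.
move=> jG GB; pose P n q x := \sum_(p < n) G p q x.
have B0 q : 0 <= B q by have := le_trans (normr_ge0 _) (GB 0%N q 0); rewrite mulr1.
have Pc q x : cvgn (fun n => P n q x).
  rewrite (_ : (fun n => P n q x) = series (fun p => G p q x)); last first.
    by apply/funext => n; rewrite /series/= big_mkord.
  apply: normed_cvg.
  apply: (@series_le_cvg _ _ (fun p => B q * 2^-1 ^+ p)) => [p|p|p|].
  - exact: normr_ge0.
  - by rewrite mulr_ge0 ?exprn_ge0.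
  - exact: GB.
  - by apply: is_cvg_geometric_series; rewrite ger0_norm// invf_lt1 ?ltr1n.
have Pl q x : P n q x @[n --> \oo] --> limn (fun n => P n q x) by exact: Pc.
have Pb n C q x : (forall p, `|G p q x| <= C * 2^-1 ^+ p) -> `|P n q x| <= C * 2.
  move=> GC; apply: le_trans (ler_norm_sum _ _ _) _.
  apply: (@le_trans _ _ (\sum_(p < n) C * 2^-1 ^+ p)); first by apply: ler_sum => p _.
  rewrite -mulr_sumr ler_wpM2l ?half_sum_le//.
  by have := le_trans (normr_ge0 _) (GC 0%N); rewrite mulr1.
exists (fun q x => limn (fun n => P n q x)) => [q x|].
  have jP n : jet (P n) by exact: (@jet_sum _ n G jG).
  apply: (@is_derive_limit _ (fun n => P n q) (fun n => P n q.+1)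
    (fun x => limn (fun n => P n q x)) (fun x => limn (fun n => P n q.+1 x))
    (B q.+2 * 2)) => //.
    by move=> n z; exact: jP.
  move=> n y z; apply: lipschitz_of_derive => [v|v]; first exact: jP.
  exact: Pb.
split=> [C q x GC|q r x Gr].
  have : `|P n q x| @[n --> \oo] --> `|limn (fun n => P n q x)| by exact: cvg_norm.
  by move/cvgr_to_le; apply; near=> n; exact: Pb.
apply/cvg_lim => //; apply: cvg_near_cst; near=> n.
have rn : (r < n)%N by near: n; exact: nbhs_infty_gt.
rewrite /P (bigD1 (Ordinal rn))//= big1 ?addr0// => i ir.
by apply: Gr; rewrite -val_eqE in ir.
Unshelve. all: by end_near. Qed.

End Series.

Section Extension.
Variables (R : realType) (N : nat -> R).
Hypothesis HN : LC N.
Hypothesis Nfin : (tail_sum N 1 < +oo)%E.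

(** The b_p majorize the p-th roots of |a_p| / L^1_p for p > 0. The p-th block
is rescaled by d_p = 12 rho_p + 2 K b_p: the first summand keeps the support inside [-1, 1], and
the second one makes the p-th term at most 2^-p (2 d_p)^q N_q, up to a constant.
Bounded d_p give a Roumieu bound. If b_p tends to 0 then so does d_p, and for
given h all but finitely many terms satisfy 2 d_p <= h; the exceptional terms
are of Beurling type individually. *)
Lemma real_extension (a b : nat -> R) (B : R) :
  (forall p, 0 <= b p <= B) ->
  (forall p, (0 < p)%N -> `|a p| <= b p ^+ p * L_seq N 1 p) ->
  exists2 F, jet F & [/\
    forall q x, 1 < `|x| -> F q x = 0,
    forall q, F q 0 = a q,
    exists h, [/\ 0 < h & exists2 C, 0 <= C & forall q x, `|F q x| <= C * (h ^+ q * N q)] &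
    b @ \oo --> (0 : R) -> beurling_class N F].
Proof.
move=> b01 ab.
have [A [K [A0 K0 /choice[Fs FsP]]]] : exists A K : R, [/\ 0 < A, 0 < K & forall p,
    exists F, jet F /\ [/\ forall q x, `|F q x| * L_seq N 1 p <= A * K ^+ p * (2 ^+ q * N q),
    forall q x, 12 * rho N p < `|x| -> F q x = 0,
    forall q, F q 0 = (q == p)%:R & beurling_class N F]].
  have [A [K [A0 K0 AP]]] := blocks HN Nfin; exists A, K; split=> // p.
  by have [F ? ?] := AP p; exists F.
have [d dE] : exists d : nat -> R, forall p, d p = 12 * rho N p + 2 * K * b p.
  by eexists.
have b0 p : 0 <= b p by case/andP: (b01 p).
have dp p : 0 < d p.
  by rewrite dE ltr_pwDl ?mulr_ge0 ?(ltW K0)// mulr_gt0 ?rho_gt0.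
have [D D0 dD] : exists2 D, 0 < D & forall p, d p <= D.
  exists (12 * rho N 0 + 2 * K * B) => [|p].
    apply: (lt_le_trans (dp 0%N)); rewrite dE lerD2l ler_wpM2l ?mulr_ge0 ?(ltW K0)//.
    by case/andP: (b01 0%N).
  rewrite dE lerD ?ler_wpM2l ?mulr_ge0 ?(ltW K0)//; first exact: rho_le.
  by case/andP: (b01 p).
pose G p q x := a p / d p ^+ p * (d p ^+ q * Fs p q (d p * x + 0)).
have jG p : jet (G p).
  by apply: jetZ; apply: jet_affine; have [] := FsP p.
pose E := A * (1 + `|a 0%N|).
have E0 : 0 <= E by rewrite mulr_ge0 ?addr_ge0// ltW.
have coef p : `|a p| * (A * K ^+ p) <= d p ^+ p * L_seq N 1 p * E * 2^-1 ^+ p.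
  case: p => [|p].
    by rewrite !expr0 !mulr1 mul1r mulrC ler_wpM2l ?(ltW A0)// lerDr.
  have L0 := L_seq_gt0 HN Nfin p.+1.
  apply: le_trans (ler_wpM2r _ (ab p.+1 isT)) _.
    by rewrite mulr_ge0 ?exprn_ge0 ?ltW.
  rewrite [leLHS](_ : _ = (b p.+1 * K) ^+ p.+1 * (L_seq N 1 p.+1 * A)); last first.
    by rewrite exprMn; ring.
  rewrite [leRHS](_ : _ = (d p.+1 / 2) ^+ p.+1 * (L_seq N 1 p.+1 * E)); last first.
    by rewrite exprMn; ring.
  apply: ler_pM.
  - by rewrite exprn_ge0// mulr_ge0// ltW.
  - by rewrite mulr_ge0 ?ltW.
  - apply: lerXn2r; rewrite ?nnegrE.
    + by rewrite mulr_ge0// ltW.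
    + by rewrite divr_ge0 ?(ltW (dp _)).
    + rewrite dE; have := rho_gt0 HN Nfin p.+1; lra.
  - rewrite ler_wpM2l ?(ltW L0)// /E ler_peMr ?(ltW A0)// lerDl//.
have GB p q x : `|G p q x| <= E * 2^-1 ^+ p * ((2 * d p) ^+ q * N q).
  have [_ [FB _ _ _]] := FsP p; have L0 := L_seq_gt0 HN Nfin p.
  have dpp : 0 < d p ^+ p by rewrite exprn_gt0.
  have dpq : 0 < d p ^+ q by rewrite exprn_gt0.
  have Nq : 0 <= 2 ^+ q * N q by rewrite mulr_ge0 ?exprn_ge0 ?(ltW (LC_gt0 HN _)).
  rewrite /G !normrM normfV (gtr0_norm dpp) (gtr0_norm dpq).
  have FB' := FB q (d p * x + 0); move: FB' (coef p).
  move: (Fs _ _ _) (L_seq _ _ _) L0 (K ^+ p) => f L L0 Kp FB' cp.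
  rewrite mulrAC ler_pdivrMr// -(ler_pM2r L0).
  rewrite [leLHS](_ : _ = `|a p| * d p ^+ q * (`|f| * L)); last by ring.
  apply: le_trans (ler_wpM2l _ FB') _; first by rewrite mulr_ge0 ?(ltW dpq).
  rewrite [leLHS](_ : _ = `|a p| * (A * Kp) * (d p ^+ q * (2 ^+ q * N q))); last by ring.
  apply: le_trans (ler_wpM2r _ cp) _; first by rewrite mulr_ge0 ?(ltW dpq).
  by rewrite exprMn le_eqVlt; apply/orP; left; apply/eqP; ring.
have [|S jS [Sb Sv]] := @jet_series R G (fun q => E * ((2 * D) ^+ q * N q)) jG.
  move=> p q x; apply: le_trans (GB p q x) _; rewrite mulrAC.
  rewrite ler_wpM2r ?exprn_ge0// ler_wpM2l// ler_wpM2r ?(ltW (LC_gt0 HN _))//.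
  by rewrite lerXn2r ?nnegrE ?mulr_ge0 ?(ltW (dp _)) ?(ltW D0)// ler_wpM2l.
exists S => //; split.
- move=> q x x1; apply/eqP; rewrite -normr_le0; apply: le_trans (Sb 0 q x _) _; last by rewrite mul0r.
  move=> p; rewrite mul0r /G; have [_ [_ FS _ _]] := FsP p; rewrite FS ?mulr0 ?normr0//.
  rewrite addr0 normrM (gtr0_norm (dp p)).
  apply: (@le_lt_trans _ _ (d p * 1)); last by rewrite ltr_pM2l.
  by rewrite mulr1 dE lerDl !mulr_ge0// ltW.
- move=> q; have [_ [_ _ Fq _]] := FsP q.
  rewrite (Sv q q 0) => [|p pq]; rewrite /G mulr0 addr0.
    by rewrite Fq eqxx mulr1 divfK// gt_eqF// exprn_gt0.
  by have [_ [_ _ F0 _]] := FsP p; rewrite F0 eq_sym (negPf pq) !mulr0.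
- exists (2 * D); split; first by rewrite mulr_gt0.
  exists (E * 2) => [|q x]; first by rewrite mulr_ge0.
  rewrite mulrAC; apply: Sb => p; apply: le_trans (GB p q x) _; rewrite mulrAC.
  rewrite ler_wpM2r ?exprn_ge0// ler_wpM2l// ler_wpM2r ?(ltW (LC_gt0 HN _))//.
  by rewrite lerXn2r ?nnegrE ?mulr_ge0 ?(ltW (dp _)) ?(ltW D0)// ler_wpM2l.
- move=> bto0 h h0.
  have dto0 : d p @[p --> \oo] --> (0 : R).
    rewrite (_ : 0 = 12 * 0 + 2 * K * 0 :> R); last by rewrite !mulr0 addr0.
    rewrite (_ : d = fun p => 12 * rho N p + 2 * K * b p); last exact/funext.
    by apply: cvgD; apply: cvgMl_tmp => //; exact: rho_cvg0.
  have [P PP] : exists P, forall p, (P <= p)%N -> 2 * d p <= h.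
    have h2 : 0 < h / 2 by rewrite divr_gt0.
    have /cvgrPdist_le/(_ _ h2)[P _ PH] := dto0.
    exists P => p /PH /=; rewrite sub0r normrN ger0_norm ?(ltW (dp p))//; lra.
  have /choice[C CP] p : exists C, 0 <= C /\ forall q x, `|G p q x| <= C * (h ^+ q * N q).
    have hd : 0 < h / d p by rewrite divr_gt0.
    have [_ [_ _ _ /(_ _ hd)[C C0 FC]]] := FsP p.
    exists (`|a p / d p ^+ p| * C); split=> [|q x]; first by rewrite mulr_ge0.
    rewrite /G normrM -mulrA ler_wpM2l// normrM normrX (gtr0_norm (dp p)).
    apply: le_trans (ler_wpM2l _ (FC q _)) _; first by rewrite exprn_ge0// ltW.
    rewrite exprMn exprVn le_eqVlt; apply/orP; left; apply/eqP; field.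
    by rewrite gt_eqF// exprn_gt0.
  have C0 p : 0 <= C p by case: (CP p).
  pose E' := E + \sum_(p < P) C p * 2 ^+ p.
  have S0 : 0 <= \sum_(p < P) C p * 2 ^+ p.
    by apply: sumr_ge0 => p _; rewrite mulr_ge0 ?exprn_ge0.
  have hN q : 0 <= h ^+ q * N q by rewrite mulr_ge0 ?exprn_ge0 ?(ltW h0) ?(ltW (LC_gt0 HN _)).
  exists (E' * 2) => [|q x]; first by rewrite mulr_ge0// addr_ge0.
  rewrite mulrAC; apply: Sb => p.
  have [Pp|pP] := leqP P p.
    apply: le_trans (GB p q x) _; rewrite mulrAC ler_wpM2r ?exprn_ge0//.
    apply: ler_pM => //; rewrite ?mulr_ge0 ?exprn_ge0 ?mulr_ge0 ?(ltW (dp _)) ?(ltW (LC_gt0 HN _))//.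
      by rewrite lerDl.
    rewrite ler_wpM2r ?(ltW (LC_gt0 HN _))//.
    by rewrite lerXn2r ?nnegrE ?mulr_ge0 ?(ltW (dp _)) ?(ltW h0)// PP.
  have [_ Gp] := CP p; apply: le_trans (Gp q x) _.
  rewrite mulrAC ler_wpM2r// exprVn ler_pdivlMr ?exprn_gt0//.
  rewrite /E' (bigD1 (Ordinal pP))//= addrCA lerDl addr_ge0//.
  by apply: sumr_ge0 => i _; rewrite mulr_ge0 ?exprn_ge0.
Qed.

End Extension.

(** * The largest weight *)

Section Conclusion.
Variables (R : realType) (N : nat -> R).
Hypothesis HN : LC N.

Let N0 : positive_seq N. Proof. by move=> p; exact: LC_gt0. Qed.

Lemma D_h_pair (F G : nat -> R -> R) (h C : R) : 0 < h -> jet F -> jet G ->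
  (forall x, 1 < `|x| -> F 0 x = 0 /\ G 0 x = 0) ->
  (forall q x, `|F q x| <= C * (h ^+ q * N q)) ->
  (forall q x, `|G q x| <= C * (h ^+ q * N q)) ->
  D_h N h (fun x => (F 0 x +i* G 0 x)%C).
Proof.
move=> h0 jF jG FG0 FC GC; set f := (X in D_h _ _ X).
have reE p : derive1n p (re_part f) = F p by rewrite -(jet_derive1n jF).
have imE p : derive1n p (im_part f) = G p by rewrite -(jet_derive1n jG).
split.
- by move=> p x; rewrite reE imE; split; [case: (jF p x)|case: (jG p x)].
- rewrite /supp; have cl : closed [set x : R | -1 <= x <= 1].
    rewrite (_ : [set x : R | _] = `[-1, 1]%classic); first exact: itv_closed.
    by apply/seteqP; split=> x; rewrite /= in_itv.
  rewrite [X in _ `<=` X](closure_id _).1//; apply: closure_subset.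
  move=> x /= fx; rewrite -ler_norml leNgt; apply: contra fx => /FG0[Fx Gx].
  by rewrite /f Fx Gx.
- exists (C + C) => _ [[p x] _ <-].
  rewrite -[X in X <= _]/(Normc.normc (cderive f p x) / (h ^+ p * N p)).
  rewrite ler_pdivrMr ?mulr_gt0 ?exprn_gt0//.
  apply: le_trans (normc_le_ReIm _) _.
  by rewrite /cderive /= reE imE mulrDl lerD.
Qed.

Lemma Lambda_le (M : nat -> R) (h : R) (a : nat -> R[i]) : positive_seq M -> 0 < h ->
  Lambda_h M h a -> exists2 C, 1 <= C & forall p, Normc.normc (a p) <= C * (h ^+ p * M p).
Proof.
move=> M0 h0 [C aC]; exists (Num.max 1 C) => [|p]; first by rewrite le_max lexx.
rewrite -ler_pdivrMr ?mulr_gt0 ?exprn_gt0//.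
by apply: le_trans (aC _ (ex_intro2 _ _ p I erefl)) _; rewrite le_max lexx orbT.
Qed.

Lemma Beurling_Roumieu_Lambda (M : nat -> R) : Lambda_Beurling M `<=` Lambda_Roumieu M.
Proof. by move=> a aM; exists 1 => /=; [exact: ltr01|apply: aM; exact: ltr01]. Qed.

Lemma Beurling_Roumieu_D : D_Beurling N `<=` D_Roumieu N.
Proof. by move=> a aM; exists 1 => /=; [exact: ltr01|apply: aM; exact: ltr01]. Qed.

Lemma quasianalytic_no_extension (M : nat -> R) : tail_sum N 1 = +oo%E -> positive_seq M ->
  ~ (Lambda_Beurling M `<=` @Borel_map R @` D_Roumieu N).
Proof.
move=> Noo M0 Mext.
have [|f [h /= h0 fD] fB] := Mext (fun p => (p == 0%N)%:R).
  move=> h /= h0; exists (M 0%N)^-1 => _ [p _ <-].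
  case: p => [|p]; first by rewrite Normc.normc1 mul1r expr0 mul1r.
  by rewrite Normc.normc0 mul0r invr_ge0 ltW.
have [F jF [C [C0 FC Fl FB]]] := D_h_jet N0 h0 fD.
have := quasianalytic HN Noo C0 h0 jF FC Fl.
by rewrite FB fB /= => /eqP; rewrite oner_eq0.
Qed.

Hypothesis Nfin : (tail_sum N 1 < +oo)%E.

(** Powers of 2 are harmless up to equivalence, and bring L^1 below N. *)
Definition max_weight (p : nat) : R := L_seq N 1 p / 2 ^+ p.

Lemma max_weight_gt0 : positive_seq max_weight.
Proof. by move=> p; rewrite divr_gt0 ?exprn_gt0// L_seq_gt0. Qed.

Lemma max_weight_le p : max_weight p <= N p.
Proof. by rewrite ler_pdivrMr ?exprn_gt0// mulrC L_seq_le_weight. Qed.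

Lemma max_weight_equiv s : (0 < s)%N -> equiv_seq max_weight (L_seq N s).
Proof.
move=> s0; have sR : 0 < (s%:R : R) by rewrite ltr0n.
have Ls : positive_seq (L_seq N s).
  by case=> [|p]; rewrite ?ltr01// L_seqE// mulr_gt0 ?exprn_gt0// L_seq_gt0.
split; apply/preceqP => //; try exact: max_weight_gt0.
  exists 1 => // p p0; rewrite expr1n mul1r L_seqE//.
  have L0 := L_seq_gt0 HN Nfin p.
  rewrite /max_weight mulrC ler_wpM2r ?(ltW L0)//.
  apply: (@le_trans _ _ 1); first by rewrite invf_le1 ?exprn_gt0// exprn_ege1// ler1n.
  by rewrite exprn_ege1// ler1n.
exists (s%:R * 2) => [|p p0]; first by rewrite mulr_gt0.
rewrite L_seqE// /max_weight exprMn -mulrA.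
by rewrite [2 ^+ p * _]mulrC divfK// gt_eqF// exprn_gt0.
Qed.

Lemma preceq_max_weight (M : nat -> R) : positive_seq M -> preceq M (L_seq N 1) ->
  preceq M max_weight.
Proof.
move=> M0 /preceqP[//||C C0 MC]; first by move=> p; exact: L_seq_gt0.
apply/preceqP => //; first exact: max_weight_gt0.
exists (C * 2) => [|p p0]; first by rewrite mulr_gt0.
rewrite /max_weight exprMn -mulrA [2 ^+ p * _]mulrC divfK ?MC//.
Qed.

(** By [sum_quotient_ge], N_(P+d) is at least d! divided by the d-th power of a
part of the tail rho_P, which is as small as desired. *)
Lemma weight_fact (A : R) : 0 < A -> exists2 K, 0 < K & forall j, A ^+ j * j`!%:R <= K * N j.
Proof.
move=> A0; have A2 : 0 < (2 * A)^-1 by rewrite invr_gt0 mulr_gt0.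
have [P PP] := rho_small HN Nfin A2.
have big d : A ^+ (P + d) * (P + d)`!%:R <= (2 * A) ^+ P * P`!%:R * N (P + d)%N.
  have := sum_quotient_ge HN P d; set S := \sum_(_ <= _ < _) _ => SP.
  have S0 : 0 <= S by apply: sumr_ge0 => k _; rewrite invr_ge0 ltW// quotient_gt0.
  have SA : S <= (2 * A)^-1.
    apply: le_trans (PP _ (leqnSn P)).
    rewrite (@rho_split _ _ HN Nfin P.+1 (P + d).+1) ?ltnS ?leq_addr// lerDl.
    by rewrite ltW// rho_gt0.
  have Nd := LC_gt0 HN (P + d).
  have dN : (2 * A) ^+ d * d`!%:R <= N (P + d)%N.
    have : d`!%:R <= (2 * A)^-1 ^+ d * N (P + d)%N.
      apply: (@le_trans _ _ (S ^+ d * N (P + d)%N)).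
        by apply: le_trans SP; rewrite ler_peMr ?ler0n ?LC_ge1.
      by rewrite ler_wpM2r ?(ltW Nd)// lerXn2r ?nnegrE ?(ltW A2).
    by rewrite exprVn mulrC ler_pdivlMr ?exprn_gt0 ?mulr_gt0// mulrC.
  have cb : (P + d)`!%:R <= 2 ^+ (P + d) * P`!%:R * d`!%:R :> R.
    rewrite -!natrX -!natrM ler_nat -(bin_fact (leq_addl P d)) addnK.
    by rewrite -mulnA [(d`! * P`!)%N]mulnC leq_mul2r leq_bin_expn orbT.
  apply: (@le_trans _ _ ((2 * A) ^+ P * P`!%:R * ((2 * A) ^+ d * d`!%:R))).
    apply: le_trans (ler_wpM2l _ cb) _; first by rewrite exprn_ge0// ltW.
    by rewrite !exprMn !exprD le_eqVlt; apply/orP; left; apply/eqP; ring.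
  by rewrite ler_wpM2l// !mulr_ge0 ?exprn_ge0// mulr_ge0// ltW.
exists ((2 * A) ^+ P * P`!%:R + \sum_(j < P) A ^+ j * j`!%:R) => [|j].
  rewrite ltr_pwDl//; first by rewrite mulr_gt0 ?exprn_gt0 ?mulr_gt0// ltr0n fact_gt0.
  by apply: sumr_ge0 => j _; rewrite mulr_ge0 ?exprn_ge0// ltW.
have Nj := LC_ge1 HN j.
have sum0 (Q : pred 'I_P) : 0 <= \sum_(j < P | Q j) A ^+ j * j`!%:R.
  by apply: sumr_ge0 => i _; rewrite mulr_ge0 ?exprn_ge0// ltW.
have P0 : 0 <= (2 * A) ^+ P * P`!%:R by rewrite mulr_ge0 ?exprn_ge0 ?mulr_ge0// ltW.
have [jP|Pj] := ltnP j P.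
  rewrite (bigD1 (Ordinal jP))//= addrCA mulrDl.
  have a0 : 0 <= A ^+ j * j`!%:R by rewrite mulr_ge0 ?exprn_ge0// ltW.
  apply: (@le_trans _ _ (A ^+ j * j`!%:R * N j)); first by rewrite ler_peMr.
  by rewrite lerDl mulr_ge0 ?addr_ge0 ?sum0// (le_trans ler01).
have := big (j - P)%N; rewrite subnKC// => /le_trans; apply.
by rewrite [leRHS]mulrDl lerDl mulr_ge0// ?sum0// (le_trans ler01).
Qed.

Lemma fact_le_expn_mul (j p : nat) : (j <= p)%N -> (p`! <= p ^ (p - j) * j`!)%N.
Proof.
move=> jp; suff H d : (j + d <= p)%N -> ((j + d)`! <= p ^ d * j`!)%N.
  by rewrite -{1}(subnKC jp) H ?subnKC.
elim: d => [|d IH] dp; first by rewrite addn0 mul1n.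
rewrite addnS factS expnS -mulnA leq_mul// -?addnS// IH// ltnW//.
by rewrite -addnS.
Qed.

Lemma root_seq_max_weight : root_seq max_weight @ \oo --> +oo.
Proof.
apply/cvgryPge => A.
pose B := Num.max A 1.
have B1 : 1 <= B by rewrite le_max lexx orbT.
have B0 : 0 < B by apply: lt_le_trans B1.
have B4 : 0 < 4 * B by rewrite mulr_gt0.
have [K K0 NK] := weight_fact B4.
have B4i : 0 < (4 * B)^-1 by rewrite invr_gt0.
have [P PP] := rho_small HN Nfin B4i.
near=> p.
have p0 : (0 < p)%N by near: p; exact: nbhs_infty_gt.
have Pp : (P <= p)%N by near: p; exact: nbhs_infty_ge.
have Kp : K <= 2 ^+ p.
  apply: (@le_trans _ _ (Num.bound K)%:R); first by apply/ltW/archi_boundP/ltW.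
  rewrite -natrX ler_nat; apply: (@leq_trans p); last by rewrite ltnW// ltn_expl.
  by near: p; exact: nbhs_infty_ge.
have pf : 0 < (p`!%:R : R) by rewrite ltr0n fact_gt0.
have M0 := max_weight_gt0 p.
apply: (@le_trans _ _ B); first by rewrite le_max lexx.
rewrite leNgt -(ltr_pXn2r p0) ?nnegrE ?powR_ge0 ?(ltW B0)// -leNgt.
rewrite -[leRHS]powR_mulrn ?powR_ge0// -powRrM mulVf ?pnatr_eq0 -?lt0n// powRr1; last first.
  by rewrite divr_ge0 ?ltW.
rewrite ler_pdivlMr// /max_weight ler_pdivlMr ?exprn_gt0//.
apply: le_L_seq => // j jp.
have sl : 4 * B * p%:R <= slope N p.
  rewrite slope_def mulrC ler_wpM2l ?ler0n// -[leLHS]invrK.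
  rewrite lef_pV2 ?posrE ?rho_gt0//.
  exact: PP.
apply: (@le_trans _ _ ((4 * B * p%:R) ^+ (p - j) * N j)); last first.
  rewrite ler_wpM2r ?(ltW (LC_gt0 HN _))//.
  by rewrite lerXn2r ?nnegrE ?mulr_ge0 ?(ltW B0) ?slope_ge0.
rewrite -(ler_pM2l K0).
apply: (@le_trans _ _ ((4 * B * p%:R) ^+ (p - j) * ((4 * B) ^+ j * j`!%:R))); last first.
  by rewrite [leRHS]mulrCA ler_wpM2l// exprn_ge0// !mulr_ge0// ltW.
apply: (@le_trans _ _ ((4 * B) ^+ p * p`!%:R)).
  rewrite (_ : 4 * B = 2 * (B * 2)); last by ring.
  rewrite exprMn -[leRHS]mulrA; apply: ler_pM => //; first exact: ltW.
    by rewrite !mulr_ge0 ?exprn_ge0 ?(ltW B0).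
  by rewrite exprMn mulrAC.
rewrite [in leRHS]exprMn mulrACA -exprD subnK 1?ltnW// ler_wpM2l ?exprn_ge0 ?(ltW B4)//.
by rewrite -natrX -natrM ler_nat fact_le_expn_mul// ltnW.
Unshelve. all: by end_near. Qed.

End Conclusion.

Section Main.
Variables (R : realType) (N : nat -> R).
Hypothesis HN : LC N.
Hypothesis Nfin : (tail_sum N 1 < +oo)%E.

Let N0 : positive_seq N. Proof. by move=> p; exact: LC_gt0. Qed.

Lemma max_weight_le_L_seq p : max_weight N p <= L_seq N 1 p.
Proof.
rewrite ler_pdivrMr ?exprn_gt0// ler_peMr ?(ltW (L_seq_gt0 HN Nfin p))//.
by rewrite exprn_ege1// ler1n.
Qed.

(** One and the same function serves both types: the roots b_p are bounded
in the Roumieu case, and tend to 0 in the Beurling case. *)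
Lemma max_weight_extension (a : nat -> R[i]) : Lambda_Roumieu (max_weight N) a ->
  exists f, [/\ Borel_map f = a, D_Roumieu N f &
    Lambda_Beurling (max_weight N) a -> D_Beurling N f].
Proof.
move=> [h0 /= h00 aR]; have L0 p := L_seq_gt0 HN Nfin p.
have M0 := max_weight_gt0 HN Nfin.
pose r p := Normc.normc (a p) / L_seq N 1 p.
have na p : 0 <= Normc.normc (a p) by case: (a p) => x y /=; exact: sqrtr_ge0.
have r0 p : 0 <= r p by rewrite divr_ge0// ltW.
have r_le h C p : 0 < h -> 1 <= C -> (forall p, Normc.normc (a p) <= C * (h ^+ p * max_weight N p)) ->
    r p <= C * h ^+ p.
  move=> hh C1 aC; rewrite ler_pdivrMr//; apply: le_trans (aC p) _; rewrite mulrA.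
  rewrite ler_wpM2l ?max_weight_le_L_seq// mulr_ge0 ?exprn_ge0 ?(ltW hh)//.
  exact: le_trans C1.
pose b p := r p `^ (p%:R)^-1.
have [C C1 aC] := Lambda_le M0 h00 aR.
have C0 : 0 <= C by apply: le_trans C1.
have bB p : 0 <= b p <= 1 + C * h0.
  rewrite powR_ge0/=; have Ch : 0 <= C * h0 by rewrite mulr_ge0// ltW.
  case: p => [|p]; first by rewrite /b invr0 powRr0 lerDl.
  rewrite powR_root_ler ?addr_ge0//; apply: le_trans (r_le _ _ p.+1 h00 C1 aC) _.
  apply: (@le_trans _ _ ((C * h0) ^+ p.+1)).
    by rewrite exprMn ler_wpM2r ?exprn_ge0 ?(ltW h00)// ler_eXnr.
  by rewrite lerXn2r ?nnegrE ?addr_ge0// lerDr.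
have ab p : (0 < p)%N -> Normc.normc (a p) <= b p ^+ p * L_seq N 1 p.
  move=> p0; rewrite -ler_pdivrMr// -/(r p) -powR_mulrn ?powR_ge0// -powRrM.
  by rewrite mulVf ?powRr1// pnatr_eq0 -lt0n.
have [F jF [F1 F0 [h1 [h10 [C1' C10 FC]]] FB]] := real_extension HN Nfin bB
  (fun p p0 => le_trans (normc_Re_le (a p)) (ab p p0)).
have nIm (z : R[i]) : `|complex.Im z| <= Normc.normc z.
  by case: z => x y /=; rewrite -sqrtr_sqr ler_wsqrtr// lerDr sqr_ge0.
have [G jG [G1 G0 [h2 [h20 [C2 C20 GC]]] GB]] := real_extension HN Nfin bB
  (fun p p0 => le_trans (nIm (a p)) (ab p p0)).
exists (fun x => (F 0 x +i* G 0 x)%C).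
have out x : 1 < `|x| -> F 0 x = 0 /\ G 0 x = 0 by move=> x1; rewrite F1 ?G1.
have widen (h h' K K' : R) (H : nat -> R -> R) : 0 <= h <= h' -> 0 <= K <= K' ->
    (forall q x, `|H q x| <= K * (h ^+ q * N q)) ->
    forall q x, `|H q x| <= K' * (h' ^+ q * N q).
  move=> /andP[hh hh'] /andP[KK KK'] HK q x; apply: le_trans (HK q x) _.
  rewrite ler_pM// ?mulr_ge0 ?exprn_ge0 ?(ltW (N0 _))//.
  by rewrite ler_wpM2r ?(ltW (N0 _))// lerXn2r ?nnegrE// (le_trans hh).
split.
- apply/funext => p; rewrite /Borel_map /cderive.
  rewrite -[re_part _]/(F 0) -[im_part _]/(G 0) !jet_derive1n// F0 G0.
  by case: (a p).
- exists (h1 + h2) => /=; first by rewrite addr_gt0.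
  apply: (@D_h_pair _ _ HN F G _ (C1' + C2)) => //; first by rewrite addr_gt0.
    by apply: (widen h1 _ C1' _ _ _ _ FC); rewrite ?C10 ?(ltW h10) lerDl// ltW.
  by apply: (widen h2 _ C2 _ _ _ _ GC); rewrite ?C20 ?(ltW h20) lerDr// ltW.
- move=> aB h /= hh.
  have bto0 : b @ \oo --> (0 : R).
    apply/cvgrPdist_le => e e0; have e2 : 0 < e / 2 by rewrite divr_gt0.
    have [K K1 aK] := Lambda_le M0 e2 (aB _ e2).
    near=> p; have p0 : (0 < p)%N by near: p; exact: nbhs_infty_gt.
    rewrite sub0r normrN ger0_norm ?powR_ge0// powR_root_ler ?(ltW e0)//.
    apply: le_trans (r_le _ _ p e2 K1 aK) _.
    rewrite expr_div_n mulrCA ler_piMr ?exprn_ge0 ?(ltW e0)// ler_pdivrMr ?exprn_gt0// mul1r.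
    apply: (@le_trans _ _ (Num.bound K)%:R).
      by apply/ltW/archi_boundP; exact: le_trans K1.
    rewrite -natrX ler_nat; apply: (@leq_trans p); last by rewrite ltnW// ltn_expl.
    by near: p; exact: nbhs_infty_ge.
  have [K1 K10 FK] := FB bto0 h hh; have [K2 K20 GK] := GB bto0 h hh.
  apply: (@D_h_pair _ _ HN F G _ (K1 + K2)) => //.
    by apply: (widen h _ K1 _ _ _ _ FK); rewrite ?K10 ?(ltW hh) ?lerDl ?lexx.
  by apply: (widen h _ K2 _ _ _ _ GK); rewrite ?K20 ?(ltW hh) ?lerDr ?lexx.
Unshelve. all: by end_near. Qed.

Lemma max_weight_maximal (S : set (nat -> R)) : S (max_weight N) ->
  (forall M, S M -> preceq M (max_weight N)) -> has_maximal_elt_given_by S (L_seq N).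
Proof.
move=> SM Smax; exists (max_weight N); split=> //.
- by split=> // M' /Smax.
- by move=> s s0; exact: max_weight_equiv.
Qed.

Lemma root_seq_einf (M : nat -> R) : root_seq M @ \oo --> +oo ->
  (0 < limn_einf (fun p => (root_seq M p)%:E))%E.
Proof. by move=> /cvgeryP/cvg_limn_einf_sup[-> _]; exact: ltry. Qed.

End Main.

Theorem theorem1p1 (R : realType) (N : nat -> R) (HN : LC N) :
  ((tail_sum N 1 < +oo)%E ->
     has_maximal_elt_given_by (admissible_Roumieu N) (L_seq N) /\
     has_maximal_elt_given_by (admissible_Beurling N) (L_seq N)) /\
  ((tail_sum N 1 = +oo)%E ->
     admissible_Roumieu N = set0 /\ admissible_Beurling N = set0).
Proof.
split=> [Nfin|Noo].
- have M0 := max_weight_gt0 HN Nfin; have MN := max_weight_le HN Nfin.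
  have rt := root_seq_max_weight HN Nfin.
  split; apply: max_weight_maximal => //.
  + split=> //; first exact: root_seq_einf.
    by move=> a /(max_weight_extension HN Nfin)[f [fa fD _]]; exists f.
  + move=> M [Mpos Mle _ Mext]; apply: preceq_max_weight => //.
    apply: extension_preceq => // a /Beurling_Roumieu_Lambda; exact: Mext.
  + split=> // a aB.
    have [f [fa _ fD]] := max_weight_extension HN Nfin (Beurling_Roumieu_Lambda aB).
    by exists f => //; exact: fD.
  + move=> M [Mpos Mle _ Mext]; apply: preceq_max_weight => //.
    apply: extension_preceq => // a /Mext[f fD <-].
    by exists f => //; exact: Beurling_Roumieu_D.
- split; apply/seteqP; split=> // M [Mpos _ _ Mext];
    apply: (quasianalytic_no_extension HN Noo Mpos) => a.
  + by move/Beurling_Roumieu_Lambda; exact: Mext.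
  + by move=> /Mext[f fD <-]; exists f => //; exact: Beurling_Roumieu_D.
Qed.
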